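(* Let $m,n\ge1$ and $N=m+n$. (i) There exists $\varepsilon>0$ such that every $\Psi\in C^2(\mathbb{G}(N,m))$ with $\|\Psi-1\|_{C^2(\mathbb{G}(N,m))}\le\varepsilon$ satisfies the uniform scalar atomic condition (USAC). (ii) Every $C^1$ function $\Psi:\mathbb{G}(N,m)\to(0,\infty)$ satisfying (USAC) satisfies the atomic condition (AC).
   Context: Matrices carry the Frobenius inner product $\langle\cdot,\cdot\rangle$ and induced norm $\|\cdot\|$. $\mathbb{G}(N,m)=\{P\in\mathbb{R}^{N\times N}: P=P^t,\ P^2=P,\ \mathrm{tr}(P)=m\}$ (a compact smooth submanifold of $\mathbb{R}^{N\times N}$); $T^\perp:=\mathrm{id}-T$. The area functional corresponds to $\Psi\equiv1$. For $\Psi\in C^1(\mathbb{G}(N,m))$, $D\Psi(T)$ denotes the differential (as a matrix) of any $C^1$ extension of $\Psi$ to a neighborhood of $\mathbb{G}(N,m)$ in $\mathbb{R}^{N\times N}$, $d\Psi(T):=D\Psi(T)+D\Psi(T)^t$, and $B_\Psi(T):=\Psi(T)T+T^\perp d\Psi(T)T$ (independent of the extension). The same definition is used on $\mathbb{G}(N,n)$. The dual function $\Psi^*:\mathbb{G}(N,n)\to\mathbb{R}$ is $\Psi^*(P):=\Psi(\mathrm{id}-P)$. (USAC): there is a constant $C>0$ such that $\langle B_\Psi(T),B_{\Psi^*}(S^\perp)\rangle\ge C\|T-S\|^2$ for all $T\neq S\in\mathbb{G}(N,m)$. For a Borel probability measure $\mu$ on $\mathbb{G}(N,m)$ put $A(\mu):=\int_{\mathbb{G}(N,m)}B_\Psi(T)\,d\mu(T)\in\mathbb{R}^{N\times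 N}$. (AC) means that both of the following hold: (AC1) $\dim\ker A(\mu)\le n$ for every Borel probability measure $\mu$ on $\mathbb{G}(N,m)$; (AC2) if $\dim\ker A(\mu)=n$, then $\mu=\delta_{T_0}$ for some $T_0\in\mathbb{G}(N,m)$. *)

(* Defs.v *)
From HB Require Import structures.
From mathcomp Require Import all_boot all_order all_algebra.
From mathcomp Require Import all_classical all_reals all_analysis.
Set Implicit Arguments.
Unset Strict Implicit.
Unset Printing Implicit Defensive.
Import Order.TTheory GRing.Theory Num.Theory.
Import numFieldNormedType.Exports.
Local Open Scope classical_set_scope.
Local Open Scope ring_scope.

Definition frob (R : realType) (N : nat) (A B : 'M[R]_N) : R :=
  \tr (A^T *m B).

Definition frobnorm (R : realType) (N : nat) (A : 'M[R]_N) : R :=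
  Num.sqrt (frob A A).

Definition grass (R : realType) (N k : nat) : set 'M[R]_N :=
  [set P | [/\ P^T = P, P *m P = P & \tr P = k%:R]].
Arguments grass : clear implicits.

(* The Grassmannian as a type, with the topology induced by 'M[R]_N. *)
Definition Gr (R : realType) (N k : nat) : Type := set_type (grass R N k).

HB.instance Definition _ (R : realType) (N k : nat) :=
  Topological.copy (Gr R N k) (set_type (grass R N k)).

Definition mx_of_Gr (R : realType) (N k : nat) (T : Gr R N k) : 'M[R]_N :=
  set_val T.
Coercion mx_of_Gr : Gr >-> matrix.

Lemma grass_pid (R : realType) (m n : nat) :
  (pid_mx m : 'M[R]_(m + n)) \in grass R (m + n) m.
Proof.
apply/mem_set; split; first exact: tr_pid_mx.
  by rewrite pid_mx_id ?leq_addr.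
by rewrite pid_mx_block mxtrace_block mxtrace1 mxtrace0 addr0.
Qed.

(* Measurable types are pointed, hence must be visibly nonempty; this is why
   the ambient dimension has the form m + n here. *)
HB.instance Definition _ (R : realType) (m n : nat) :=
  isPointed.Build (Gr R (m + n) m) (exist _ (pid_mx m) (grass_pid R m n)).

Lemma grass_perp (R : realType) (N k l : nat) (h : (k + l)%N = N)
  (T : Gr R N k) : (1%:M - (T : 'M[R]_N)) \in grass R N l.
Proof.
have [Tt TT trT] : grass R N k T by exact: set_valP.
apply/mem_set; split.
- by rewrite linearB /= trmx1 Tt.
- by rewrite mulmxBl mul1mx mulmxBr mulmx1 TT subrr subr0.
- by rewrite linearB /= mxtrace1 trT -h natrD addrC addKr.
Qed.

Definition perp (R : realType) (N k l : nat) (h : (k + l)%N = N)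
  (T : Gr R N k) : Gr R N l :=
  exist _ (1%:M - (T : 'M[R]_N)) (grass_perp h T).

Definition dual (R : realType) (m n : nat) (Psi : Gr R (m + n) m -> R) :
  Gr R (m + n) n -> R :=
  fun P => Psi (perp (addnC n m) P).

Definition partial (R : realType) (N : nat) (i j : 'I_N) (F : 'M[R]_N -> R) :
  'M[R]_N -> R :=
  fun X => 'D_(delta_mx i j) F X.

(* The matrix representing the differential for the Frobenius product. *)
Definition grad (R : realType) (N : nat) (F : 'M[R]_N -> R) (X : 'M[R]_N) :
  'M[R]_N :=
  \matrix_(i, j) partial i j F X.

Definition C1_on (R : realType) (N : nat) (U : set 'M[R]_N)
  (F : 'M[R]_N -> R) : Prop :=
  forall X, U X -> differentiable F X /\ {for X, continuous (grad F)}.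

Definition C2_on (R : realType) (N : nat) (U : set 'M[R]_N)
  (F : 'M[R]_N -> R) : Prop :=
  C1_on U F /\ forall i j, C1_on U (partial i j F).

Definition C1_extension (R : realType) (N k : nat) (Psi : Gr R N k -> R) :
  set ('M[R]_N -> R) :=
  [set F : 'M[R]_N -> R | (forall T : Gr R N k, F T = Psi T) /\
     exists U, [/\ open U, grass R N k `<=` U & C1_on U F]].

Definition C2_extension (R : realType) (N k : nat) (Psi : Gr R N k -> R) :
  set ('M[R]_N -> R) :=
  [set F : 'M[R]_N -> R | (forall T : Gr R N k, F T = Psi T) /\
     exists U, [/\ open U, grass R N k `<=` U & C2_on U F]].

Definition C1_Gr (R : realType) (N k : nat) (Psi : Gr R N k -> R) : Prop :=
  exists F, C1_extension Psi F.

Definition C2_Gr (R : realType) (N k : nat) (Psi : Gr R N k -> R) : Prop :=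
  exists F, C2_extension Psi F.

Definition hessnorm (R : realType) (N : nat) (F : 'M[R]_N -> R)
  (X : 'M[R]_N) : R :=
  Num.sqrt (\sum_i \sum_j frobnorm (grad (partial i j F) X) ^+ 2).

Definition ext_C2norm (R : realType) (N k : nat) (F : 'M[R]_N -> R) : \bar R :=
  (ereal_sup [set `|F X|%:E | X in grass R N k] +
   ereal_sup [set (frobnorm (grad F X))%:E | X in grass R N k] +
   ereal_sup [set (hessnorm F X)%:E | X in grass R N k])%E.

(* The C^2 norm on the compact submanifold, as the quotient norm over all C^2
   extensions; it is equivalent to any norm defined by charts or by a
   Riemannian metric. *)
Definition C2norm (R : realType) (N k : nat) (Psi : Gr R N k -> R) : \bar R :=
  ereal_inf [set ext_C2norm k F | F in C2_extension Psi].

(* D Psi is computed from a chosen C^1 extension (the zero function if there is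
   none). It depends on the choice, but B_ below does not: multiplying
   D Psi + D Psi^t by T^perp on the left and by T on the right only retains the
   derivatives of Psi along tangent directions. *)
Definition D_ (R : realType) (N k : nat) (Psi : Gr R N k -> R) (T : Gr R N k) :
  'M[R]_N :=
  grad (xget (fun=> 0) (C1_extension Psi)) T.

Definition d_ (R : realType) (N k : nat) (Psi : Gr R N k -> R) (T : Gr R N k) :
  'M[R]_N :=
  D_ Psi T + (D_ Psi T)^T.

Definition B_ (R : realType) (N k : nat) (Psi : Gr R N k -> R) (T : Gr R N k) :
  'M[R]_N :=
  Psi T *: (T : 'M[R]_N) + (1%:M - (T : 'M[R]_N)) *m d_ Psi T *m T.

Definition uniform_scalar_atomic_condition (R : realType) (m n : nat)
  (Psi : Gr R (m + n) m -> R) : Prop :=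
  exists2 C : R, 0 < C &
    forall T S : Gr R (m + n) m, T <> S ->
      C * frobnorm ((T : 'M[R]_(m + n)) - (S : 'M[R]_(m + n))) ^+ 2 <=
      frob (B_ Psi T) (B_ (dual Psi) (perp (erefl (m + n)%N) S)).

Definition GrBorel (R : realType) (m n : nat) :=
  g_sigma_algebraType (@open (Gr R (m + n) m)).

Definition A_ (R : realType) (m n : nat) (Psi : Gr R (m + n) m -> R)
  (mu : probability (GrBorel R m n) R) : 'M[R]_(m + n) :=
  \matrix_(i, j) \int[mu]_T B_ Psi T i j.

(* kermx is the kernel of the action on row vectors, whence the transpose. *)
Definition dimker (R : realType) (N : nat) (A : 'M[R]_N) : nat :=
  \rank (kermx A^T).

(* Measures are functions on all sets, constrained on measurable ones only. *)
Definition atomic_condition (R : realType) (m n : nat)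
  (Psi : Gr R (m + n) m -> R) : Prop :=
  (forall mu : probability (GrBorel R m n) R, (dimker (A_ Psi mu) <= n)%N) /\
  (forall mu : probability (GrBorel R m n) R, dimker (A_ Psi mu) = n ->
     exists T0 : GrBorel R m n,
       forall E : set (GrBorel R m n), measurable E -> mu E = \d_T0 E).

(* Main.v *)
Require Import Defs.
From mathcomp Require Import all_boot all_order all_algebra.
From mathcomp Require Import all_classical all_reals all_analysis.
From mathcomp Require Import ring lra.
Import Order.TTheory GRing.Theory Num.Theory.
Import numFieldNormedType.Exports.
Local Open Scope classical_set_scope.
Local Open Scope ring_scope.

Set Implicit Arguments.
Unset Strict Implicit.
Unset Printing Implicit Defensive.

(* (i) Write E = T - S, let F be a C^2-small extension of Psi - 1, and H = DF +
   DF^t. As <T, id - S> = |E|^2 / 2, the form <B(T), B*(S^perp)> is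
   Psi(T) Psi(S) |E|^2 / 2 plus terms of first order in E and of size eps. The
   latter, tr(T^perp E T H(T)) and - tr(S^perp E S H(S)), cancel up to
   O(eps |E|^2), provided that F and DF are Lipschitz on the Grassmannian with a
   constant O(eps). Since the derivatives are only controlled on the
   Grassmannian itself, the Lipschitz bound is obtained by integrating along a
   path in it from S to T of length O(|T - S|), made of at most m plane
   rotations, each a rational curve.

   (ii) If dim ker A(mu) >= n, let S^perp project onto an n-plane in the kernel.
   Since B*(S^perp) = K S^perp, one has <A(mu), B*(S^perp)> = 0: the integral of
   T |-> <B(T), B*(S^perp)> >= C |T - S|^2 vanishes and mu is the Dirac mass at S.
   Then A(mu) = B(S), which has rank at least m because S B(S) = Psi(S) S. *)

(** * Frobenius product *)

(** Lagrange's identity: twice the difference of the two sides is the double sum of the squares of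
    the minors [x i * y j - x j * y i]. No root is taken. *)
Lemma cauchy_schwarz (R : realDomainType) (I : finType) (x y : I -> R) :
  (\sum_i x i * y i) ^+ 2 <= (\sum_i x i ^+ 2) * (\sum_i y i ^+ 2).
Proof.
have h : 0 <= \sum_i \sum_j (x i * y j - x j * y i) ^+ 2.
  by apply: sumr_ge0 => i _; apply: sumr_ge0 => j _; exact: sqr_ge0.
suff e : \sum_i \sum_j (x i * y j - x j * y i) ^+ 2 =
  2 * ((\sum_i x i ^+ 2) * (\sum_i y i ^+ 2) - (\sum_i x i * y i) ^+ 2).
  by rewrite e pmulr_rge0// subr_ge0 in h.
transitivity (\sum_i \sum_j ((x i ^+ 2 * y j ^+ 2 + x j ^+ 2 * y i ^+ 2)
    - 2 * ((x i * y i) * (x j * y j)))).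
  by apply: eq_bigr => i _; apply: eq_bigr => j _; ring.
have -> : forall f g k : I -> I -> R,
    \sum_i \sum_j ((f i j + g i j) - 2 * k i j) =
    (\sum_i \sum_j f i j + \sum_i \sum_j g i j) - 2 * \sum_i \sum_j k i j.
  move=> f g k; rewrite -big_split mulr_sumr -sumrB; apply: eq_bigr => i _.
  by rewrite -big_split mulr_sumr -sumrB.
rewrite [X in _ + X - _]exchange_big/=.
rewrite expr2 !big_distrlr/=; ring.
Qed.

Section frobenius.
Context {R : realType} {N : nat}.
Implicit Types A B C : 'M[R]_N.

Lemma frobE A B : frob A B = \sum_i \sum_j A i j * B i j.
Proof.
rewrite /frob /mxtrace exchange_big; apply: eq_bigr => i _.
by rewrite mxE; apply: eq_bigr => j _; rewrite mxE.
Qed.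

Lemma frob_ge0 A : 0 <= frob A A.
Proof.
rewrite frobE; apply: sumr_ge0 => i _; apply: sumr_ge0 => j _.
by rewrite -expr2 sqr_ge0.
Qed.

Lemma frobnorm_ge0 A : 0 <= frobnorm A.
Proof. exact: sqrtr_ge0. Qed.

Lemma sqr_frobnorm A : frobnorm A ^+ 2 = frob A A.
Proof. by rewrite sqr_sqrtr// frob_ge0. Qed.

Lemma frob_eq0 A : frob A A = 0 -> A = 0.
Proof.
rewrite frobE => /eqP; rewrite psumr_eq0/=; last first.
  by move=> i _; apply: sumr_ge0 => j _; rewrite -expr2 sqr_ge0.
move=> /allP h; apply/matrixP => i j; rewrite mxE.
have /= := h i (mem_index_enum _); rewrite psumr_eq0/=; last first.
  by move=> k _; rewrite -expr2 sqr_ge0.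
by move=> /allP/(_ j (mem_index_enum _))/=; rewrite -expr2 sqrf_eq0 => /eqP.
Qed.

Lemma frobC A B : frob A B = frob B A.
Proof. by rewrite /frob -mxtrace_tr trmx_mul trmxK. Qed.

Lemma frobnorm_tr A : frobnorm A^T = frobnorm A.
Proof. by rewrite /frobnorm /frob trmxK mxtrace_mulC. Qed.

Lemma frobnormN A : frobnorm (- A) = frobnorm A.
Proof.
rewrite /frobnorm !frobE; congr Num.sqrt.
by apply: eq_bigr => i _; apply: eq_bigr => j _; rewrite !mxE mulrNN.
Qed.

Lemma frob_le A B : `|frob A B| <= frobnorm A * frobnorm B.
Proof.
rewrite -(@ler_pXn2r _ 2)// ?nnegrE ?mulr_ge0 ?frobnorm_ge0//.
rewrite real_normK ?num_real// exprMn !sqr_frobnorm !frobE !pair_bigA/=.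
apply: le_trans (cauchy_schwarz _ _) _.
rewrite le_eqVlt; apply/orP; left; apply/eqP; congr (_ * _);
  by apply: eq_bigr => k _; rewrite expr2.
Qed.

Lemma frobDl A B C : frob (A + B) C = frob A C + frob B C.
Proof. by rewrite /frob linearD/= mulmxDl mxtraceD. Qed.

Lemma frobDr A B C : frob C (A + B) = frob C A + frob C B.
Proof. by rewrite /frob mulmxDr mxtraceD. Qed.

Lemma frobnormD A B : frobnorm (A + B) <= frobnorm A + frobnorm B.
Proof.
rewrite -(@ler_pXn2r _ 2)// ?nnegrE ?addr_ge0 ?frobnorm_ge0//.
rewrite sqrrD !sqr_frobnorm frobDl !frobDr (frobC B A).
have := le_trans (ler_norm _) (frob_le A B).
rewrite mulr2n; lra.
Qed.

Lemma frobnormB A B : frobnorm (A - B) <= frobnorm A + frobnorm B.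
Proof. by rewrite -(frobnormN B) frobnormD. Qed.

(** Each entry of the product is a row of [A] against a column of [B], to which Cauchy-Schwarz
    applies; exchanging the two sums of [B] makes the product of the squared norms a sum over such
    pairs. *)
Lemma frobnormM A B : frobnorm (A *m B) <= frobnorm A * frobnorm B.
Proof.
rewrite -(@ler_pXn2r _ 2)// ?nnegrE ?mulr_ge0 ?frobnorm_ge0//.
rewrite exprMn !sqr_frobnorm !frobE.
rewrite [X in _ * X]exchange_big/= big_distrlr/=.
apply: ler_sum => i _; apply: ler_sum => j _; rewrite mxE -expr2.
apply: le_trans (cauchy_schwarz _ _) _.
rewrite le_eqVlt; apply/orP; left; apply/eqP; congr (_ * _);
  by apply: eq_bigr => k _; rewrite expr2.
Qed.

Lemma mxtrace_mul_le A B : `|\tr (A *m B)| <= frobnorm A * frobnorm B.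
Proof. by rewrite -(frobnorm_tr A) -{1}(trmxK A); exact: frob_le. Qed.

Lemma entry_le A i j : `|A i j| <= frobnorm A.
Proof.
rewrite -(@ler_pXn2r _ 2)// ?nnegrE ?frobnorm_ge0//.
rewrite real_normK ?num_real// sqr_frobnorm frobE (bigD1 i)//= (bigD1 j)//=.
rewrite -expr2 -addrA lerDl addr_ge0//.
  by apply: sumr_ge0 => k _; rewrite -expr2 sqr_ge0.
by apply: sumr_ge0 => k _; apply: sumr_ge0 => l _; rewrite -expr2 sqr_ge0.
Qed.

Lemma frobnorm_le_entries A (c : R) :
  0 <= c -> (forall i j, `|A i j| <= c) -> frobnorm A <= N%:R * c.
Proof.
move=> c0 h; rewrite -(@ler_pXn2r _ 2)// ?nnegrE ?frobnorm_ge0 ?mulr_ge0//.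
rewrite sqr_frobnorm frobE.
have -> : (N%:R * c) ^+ 2 = \sum_(i < N) \sum_(j < N) c ^+ 2.
  by rewrite !sumr_const !card_ord -mulrnA -[RHS]mulr_natl natrM exprMn -expr2.
apply: ler_sum => i _; apply: ler_sum => j _; rewrite -expr2 -real_normK ?num_real//.
by rewrite ler_pXn2r// nnegrE.
Qed.

End frobenius.

(** * Orthogonal projectors and plane rotations *)

(** In the full-rank factorization [P = col_base P *m row_base P], idempotence forces
    [row_base P *m col_base P] to be the identity of size [\rank P]; the trace is cyclic. *)
Lemma idempotent_trace (F : fieldType) (N : nat) (P : 'M[F]_N) :
  P *m P = P -> \tr P = (\rank P)%:R.
Proof.
move=> PP; have : row_base P *m col_base P = 1%:M.
  have /row_fullP[B Bc] := col_base_full P.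
  have /row_freeP[C rC] := row_base_free P.
  have rE : B *m P = row_base P.
    by rewrite -[row_base P]mul1mx -Bc -mulmxA mulmx_base.
  have cE : P *m C = col_base P.
    by rewrite -[col_base P]mulmx1 -rC mulmxA mulmx_base.
  by rewrite -{1}rE -cE -mulmxA (mulmxA P) PP mulmxA rE rC.
move=> rc; transitivity (\tr (col_base P *m row_base P)).
  by rewrite mulmx_base.
by rewrite mxtrace_mulC rc mxtrace1.
Qed.

Section projectors.
Context {R : realType} {N : nat}.
Implicit Types (P Q S T : 'M[R]_N) (a b : 'cV[R]_N).

Definition sqn a : R := (a^T *m a) 0 0.

Lemma sqnE a : sqn a = \sum_i a i 0 ^+ 2.
Proof. by rewrite /sqn mxE; apply: eq_bigr => i _; rewrite mxE expr2. Qed.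

Lemma sqn_ge0 a : 0 <= sqn a.
Proof. by rewrite sqnE; apply: sumr_ge0 => i _; exact: sqr_ge0. Qed.

Lemma mul_tr_sqn a : a^T *m a = (sqn a)%:M.
Proof. by apply/matrixP => i j; rewrite !ord1 [RHS]mxE eqxx mulr1n. Qed.

Lemma sqn_eq0 a : (sqn a == 0) = (a == 0).
Proof.
apply/eqP/eqP => [|->]; last by rewrite /sqn mulmx0 mxE.
rewrite sqnE => /eqP; rewrite psumr_eq0/= => [|i _]; last exact: sqr_ge0.
move=> /allP h; apply/matrixP => i j; rewrite mxE ord1.
by have /= := h i (mem_index_enum _); rewrite sqrf_eq0 => /eqP.
Qed.

Lemma sqn_gt0 a : (0 < sqn a) = (a != 0).
Proof. by rewrite lt_def sqn_ge0 andbT sqn_eq0. Qed.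

(** For nonzero [a], the orthogonal projector onto the span of [a]. *)
Definition line a : 'M[R]_N := (sqn a)^-1 *: (a *m a^T).

Lemma line_tr a : (line a)^T = line a.
Proof. by rewrite /line linearZ/= trmx_mul trmxK. Qed.

Lemma line_mul_self a : a != 0 -> line a *m a = a.
Proof.
move=> a0; rewrite /line -scalemxAl -mulmxA mul_tr_sqn mul_mx_scalar scalerA.
by rewrite mulVf ?sqn_eq0// scale1r.
Qed.

Lemma line_idem a : a != 0 -> line a *m line a = line a.
Proof.
by move=> a0; rewrite {2}/line -scalemxAr mulmxA line_mul_self.
Qed.

Lemma line_trace a : a != 0 -> \tr (line a) = 1.
Proof.
move=> a0; rewrite /line linearZ/= mxtrace_mulC mul_tr_sqn mxtrace_scalar mulr1n.
by rewrite mulVf// sqn_eq0.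
Qed.

Lemma mul_line P a : P *m line a = (sqn a)^-1 *: ((P *m a) *m a^T).
Proof. by rewrite /line -scalemxAr mulmxA. Qed.

Lemma line_mul P a : P^T = P -> line a *m P = (sqn a)^-1 *: (a *m (P *m a)^T).
Proof. by move=> PT; rewrite /line -scalemxAl -mulmxA trmx_mul PT. Qed.

Definition projector P := P^T = P /\ P *m P = P.

Lemma projector_add P a : projector P -> P *m a = 0 -> a != 0 ->
  projector (P + line a) /\ \tr (P + line a) = \tr P + 1.
Proof.
move=> [PT PP] Pa a0; split; last by rewrite mxtraceD line_trace.
split; first by rewrite linearD/= PT line_tr.
rewrite mulmxDl !mulmxDr PP line_idem// mul_line line_mul// Pa.
by rewrite trmx0 mul0mx mulmx0 !scaler0 add0r addr0.
Qed.

Lemma projector_sub P a : projector P -> P *m a = a -> a != 0 ->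
  projector (P - line a) /\ \tr (P - line a) = \tr P - 1.
Proof.
move=> [PT PP] Pa a0; split; last by rewrite linearB/= line_trace.
split; first by rewrite linearB/= PT line_tr.
rewrite mulmxBl !mulmxBr PP line_idem// mul_line line_mul// Pa -/(line a).
by rewrite subrr subr0.
Qed.

(** The squared norm is [\tr T = k], which is also the rank of [T], hence at most [N] and so at most
    [N ^ 2]. *)
Lemma grass_frobnorm k T : grass R N k T -> frobnorm T <= N%:R.
Proof.
move=> [TT TP tT]; have kN : (k <= N)%N.
  by rewrite -(ler_nat R) -tT idempotent_trace// ler_nat rank_leq_row.
rewrite -(@ler_pXn2r _ 2)// ?nnegrE ?frobnorm_ge0//.
rewrite sqr_frobnorm /frob TT TP tT -natrX ler_nat (leq_trans kN)//.
by rewrite -mulnn; case: (N) => // n; rewrite leq_pmulr.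
Qed.

Lemma frobnorm_mulcV P a : sqn (P *m a) <= frobnorm P ^+ 2 * sqn a.
Proof.
rewrite sqr_frobnorm frobE !sqnE mulr_suml; apply: ler_sum => i _.
rewrite mxE; apply: le_trans (cauchy_schwarz _ _) _.
rewrite le_eqVlt; apply/orP; left; apply/eqP; congr (_ * _);
  by apply: eq_bigr => k _; rewrite expr2.
Qed.

Lemma frobnorm_outer a b : frobnorm (a *m b^T) ^+ 2 = sqn a * sqn b.
Proof.
rewrite sqr_frobnorm /frob trmx_mul trmxK -mulmxA mxtrace_mulC -!mulmxA.
rewrite mul_tr_sqn mulmxA mul_tr_sqn -scalar_mxM mxtrace_scalar mulr1n; ring.
Qed.

(** For [a] in im S and [b] in ker S, the direction [a] of the image turns in the plane of [a] and
    [b]. The parameter is a slope, not an angle, which makes the entries rational in [s]. *)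
Definition rotation S a b (s : R) : 'M[R]_N := S - line a + line (a + s *: b).

Section rotation.
Variables (S : 'M[R]_N) (a b : 'cV[R]_N).
Hypotheses (PS : projector S) (Sa : S *m a = a) (Sb : S *m b = 0).
Hypothesis a0 : a != 0.

Let ab : a^T *m b = 0.
Proof. by rewrite -{1}Sa trmx_mul PS.1 -mulmxA Sb mulmx0. Qed.

Let ba : b^T *m a = 0.
Proof. by rewrite -[LHS]trmxK trmx_mul trmxK ab trmx0. Qed.

Lemma sqn_rot s : sqn (a + s *: b) = sqn a + s ^+ 2 * sqn b.
Proof.
rewrite /sqn [(_ + _)^T]linearD/= [(_ *: _)^T]linearZ/= mulmxDl !mulmxDr.
rewrite -!scalemxAl -!scalemxAr ab ba.
by rewrite !scaler0 addr0 add0r scalerA -expr2 !mxE.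
Qed.

Lemma sqn_rot_ge s : sqn a <= sqn (a + s *: b).
Proof. by rewrite sqn_rot lerDl mulr_ge0 ?sqr_ge0 ?sqn_ge0. Qed.

Lemma rot_neq0 s : a + s *: b != 0.
Proof. by rewrite -sqn_gt0 (lt_le_trans _ (sqn_rot_ge s))// sqn_gt0. Qed.

(** Removing [line a] leaves a projector that kills both [a] and [b], hence [a + s *: b], whose line
    can then be added. *)
Lemma rotation_projector s :
  projector (rotation S a b s) /\ \tr (rotation S a b s) = \tr S.
Proof.
have [p1 t1] := projector_sub PS Sa a0.
have [|p2 t2] := projector_add p1 _ (rot_neq0 s).
  rewrite mulmxBl !mulmxDr Sa -!scalemxAr Sb line_mul_self//.
  by rewrite /line -!scalemxAl -mulmxA ab mulmx0 !scaler0 !addr0 subrr.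
by split => //; rewrite t2 t1 subrK.
Qed.

Lemma rotation_grass k s : grass R N k S -> grass R N k (rotation S a b s).
Proof.
by move=> [_ _ tS]; have [[? ?] t] := rotation_projector s; split=> //; rewrite t.
Qed.

Lemma rotation0 : rotation S a b 0 = S.
Proof. by rewrite /rotation scale0r addr0 subrK. Qed.

End rotation.

End projectors.

(** * Gradients and differentiation along plane rotations *)

Section gradient.
Context {R : realType} {N : nat}.
Implicit Types (F : 'M[R]_N -> R) (X V : 'M[R]_N).

Lemma diff_grad F X V : differentiable F X -> 'd F X V = frob (grad F X) V.
Proof.
move=> dF; rewrite {1}(matrix_sum_delta V) linear_sum frobE.
apply: eq_bigr => i _; rewrite linear_sum; apply: eq_bigr => j _.
by rewrite linearZ/= /grad mxE /partial deriveE// mulrC.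
Qed.

Lemma is_derive_along (c : R -> 'M[R]_N) F (s : R) V :
  differentiable F (c s) -> is_derive s 1 c V ->
  is_derive s 1 (F \o c) (frob (grad F (c s)) V).
Proof.
move=> dF [dc cV]; have {}dc : differentiable c s by apply/derivable1_diffP.
have dFc : differentiable (F \o c) s by exact: differentiable_comp.
split; first exact/derivable1_diffP.
by rewrite deriveE// in cV; rewrite deriveE// diff_comp//= cV diff_grad.
Qed.

(** The derivative of w w^T / |w|^2 for w = a + s b, where |w|^2 has derivative 2 s |b|^2 because
    [a] and [b] are orthogonal. *)
Definition velocity (a b : 'cV[R]_N) (s : R) : 'M[R]_N :=
  let w := a + s *: b in
  (sqn w)^-1 *: (b *m w^T + w *m b^T) -
  (2 * s * sqn b / sqn w ^+ 2) *: (w *m w^T).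

Section rotation.
Variables (S : 'M[R]_N) (a b : 'cV[R]_N).
Hypotheses (PS : projector S) (Sa : S *m a = a) (Sb : S *m b = 0).
Hypothesis a0 : a != 0.

Let w (s : R) := a + s *: b.

Lemma is_derive_rotation (s : R) : is_derive s 1 (rotation S a b) (velocity a b s).
Proof.
have wE (t : R) : sqn (w t) = sqn a + t ^+ 2 * sqn b by exact: sqn_rot PS Sa Sb t.
have w0 t : sqn (w t) != 0 by rewrite sqn_eq0 (rot_neq0 PS Sa Sb a0).
have dw : is_derive s 1 (fun t => sqn (w t)) (2 * s * sqn b).
  rewrite (_ : (fun t => _) = (fun t => sqn a + t ^+ 2 * sqn b)); last first.
    by apply/funext => t; rewrite wE.
  apply: is_derive_eq; rewrite /GRing.scale/=; ring.
have dV : is_derive s 1 (fun t => (sqn (w t))^-1)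
    (- (2 * s * sqn b / sqn (w s) ^+ 2)).
  have [dd dE] := dw; split; first exact: derivableV.
  by rewrite deriveV// dE /GRing.scale/=; ring.
have d i j : is_derive s 1 (fun t => rotation S a b t i j) (velocity a b s i j).
  rewrite (_ : (fun t => _) = (fun t => (S - line a) i j +
     (sqn (w t))^-1 * ((a i 0 + t * b i 0) * (a j 0 + t * b j 0)))); last first.
    by apply/funext => t; rewrite /rotation /line !mxE !big_ord1 !mxE ord1.
  apply: is_derive_eq.
  rewrite /velocity -/(w s) !mxE !big_ord1 !mxE /GRing.scale/=; ring.
have D : derivable (rotation S a b) s 1 by apply/derivable_mxP => i j; case: (d i j).
split => //; rewrite derive_mx//; apply/matrixP => i j; rewrite [LHS]mxE.
by have [_ ->] := d i j.
Qed.

(** Since |s| |b| <= |w|, each of the two terms of the velocity is at most 2 |b| / |w|, and |w| >=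
    |a|. The bound is uniform in [s]. *)
Lemma velocity_le s : frobnorm (velocity a b s) <=
  4 * Num.sqrt (sqn b) / Num.sqrt (sqn a).
Proof.
have outer (x y : 'cV[R]_N) :
    frobnorm (x *m y^T) = Num.sqrt (sqn x) * Num.sqrt (sqn y).
  by rewrite -sqrtrM ?sqn_ge0// -frobnorm_outer sqrtr_sqr ger0_norm ?frobnorm_ge0.
have frobZ (k : R) (A : 'M[R]_N) : frobnorm (k *: A) = `|k| * frobnorm A.
  rewrite /frobnorm /frob [(_ *: _)^T]linearZ/= -scalemxAl -scalemxAr scalerA.
  by rewrite [\tr _]linearZ/= sqrtrM -?expr2 ?sqr_ge0// sqrtr_sqr.
rewrite /velocity -/(w s); apply: le_trans (frobnormB _ _) _.
rewrite !frobZ outer.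
have := frobnormD (b *m (w s)^T) (w s *m b^T); rewrite !outer => h1.
have wE : sqn (w s) = sqn a + s ^+ 2 * sqn b by exact: sqn_rot PS Sa Sb s.
set al := Num.sqrt (sqn a); set be := Num.sqrt (sqn b).
set om := Num.sqrt (sqn (w s)) in h1 *.
have al0 : 0 < al by rewrite sqrtr_gt0 sqn_gt0.
have be0 : 0 <= be by exact: sqrtr_ge0.
have om0 : 0 < om by rewrite sqrtr_gt0 sqn_gt0; exact: rot_neq0 PS Sa Sb a0 s.
have be2 : sqn b = be ^+ 2 by rewrite sqr_sqrtr ?sqn_ge0.
have om2 : sqn (w s) = om ^+ 2 by rewrite sqr_sqrtr ?sqn_ge0.
have alom : al <= om by rewrite ler_sqrt ?sqn_ge0//; exact: sqn_rot_ge PS Sa Sb s.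
have som : `|s| * be <= om.
  rewrite -(@ler_pXn2r _ 2)// ?nnegrE ?mulr_ge0 ?(ltW om0)// exprMn -be2 -om2 wE.
  by rewrite real_normK ?num_real// lerDr sqn_ge0.
rewrite be2 om2 ger0_norm ?invr_ge0 ?sqr_ge0//.
have -> : `|2 * s * be ^+ 2 / om ^+ 2 ^+ 2| = `|s| * (2 * be ^+ 2 / om ^+ 2 ^+ 2).
  rewrite (_ : 2 * s * _ / _ = s * (2 * be ^+ 2 / om ^+ 2 ^+ 2)); last by ring.
  rewrite normrM [X in _ * X]ger0_norm// divr_ge0 ?sqr_ge0//.
  by apply: mulr_ge0 => //; exact: sqr_ge0.
apply: (@le_trans _ _ (4 * be / om)); last first.
  by rewrite ler_wpM2l ?mulr_ge0// lef_pV2.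
apply: (@le_trans _ _ ((om ^+ 2)^-1 * (be * om + om * be) +
   2 * (`|s| * be) * be / om ^+ 2)).
  rewrite lerD// ?ler_wpM2l// ?invr_ge0 ?sqr_ge0//.
  rewrite le_eqVlt; apply/orP; left; apply/eqP; field.
  by rewrite lt0r_neq0.
have -> : 4 * be / om = (om ^+ 2)^-1 * (be * om + om * be) + 2 * om * be / om ^+ 2.
  by field; rewrite lt0r_neq0.
rewrite lerD2l ler_wpM2r ?invr_ge0 ?sqr_ge0// ler_wpM2r// ler_wpM2l//.
Qed.

(** Mean value theorem on [0, 1]: the curve stays in the Grassmannian, so the gradient has to be
    controlled there only. *)
Lemma rotation_increment k (h : 'M[R]_N -> R) (M : R) :
  grass R N k S ->
  (forall X, grass R N k X -> differentiable h X /\ frobnorm (grad h X) <= M) ->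
  `|h (rotation S a b 1) - h S| <= M * (4 * Num.sqrt (sqn b) / Num.sqrt (sqn a)).
Proof.
move=> gS hh.
have g s : grass R N k (rotation S a b s) by exact: rotation_grass.
have d (s : R) : is_derive s 1 (h \o rotation S a b)
    (frob (grad h (rotation S a b s)) (velocity a b s)).
  by apply: is_derive_along; [have [] := hh _ (g s)|exact: is_derive_rotation].
have [|x _] := @MVT R (h \o rotation S a b) _ 0 1 ltr01 (fun s _ => d s).
  apply: continuous_subspaceT => s.
  by apply/differentiable_continuous/derivable1_diffP; case: (d s).
rewrite /= rotation0 subr0 mulr1 => ->; apply: le_trans (frob_le _ _) _.
by apply: ler_pM; rewrite ?frobnorm_ge0// ?velocity_le//; have [] := hh _ (g x).
Qed.

End rotation.
End gradient.

(** * Functions on the Grassmannian *)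

Section grassmannian.
Context {R : realType} {N : nat}.
Implicit Types (P Q S T : 'M[R]_N) (F G h : 'M[R]_N -> R).

Lemma grass_projector k T : grass R N k T -> projector T.
Proof. by case. Qed.

Lemma mx_eq0_bilinear (A : 'M[R]_N) :
  (forall x y : 'cV[R]_N, y^T *m A *m x = 0) -> A = 0.
Proof.
move=> h; apply/matrixP => i j.
have := h (delta_mx j 0) (delta_mx i 0).
rewrite trmx_delta -rowE -colE => /matrixP/(_ 0 0).
by rewrite !mxE.
Qed.

Lemma frob_outer (A : 'M[R]_N) (x y : 'cV[R]_N) :
  frob A (y *m x^T) = (y^T *m A *m x) 0 0.
Proof.
rewrite /frob mulmxA mxtrace_mulC mulmxA /mxtrace big_ord1.
transitivity ((x^T *m A^T *m y)^T 0 0); first by rewrite [RHS]mxE.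
by rewrite !trmx_mul !trmxK mulmxA.
Qed.

(** [F] and [G] agree along every rotation curve through [T], hence so do their derivatives at
    [s = 0]. There the velocity is (b a^T + a b^T) / |a|^2, and [a = T x], [b = T^perp y] with
    arbitrary [x], [y] test every entry of the two matrices. *)
Lemma tangential_grad_unique k F G T : grass R N k T ->
  differentiable F T -> differentiable G T ->
  (forall X, grass R N k X -> F X = G X) ->
  (1%:M - T) *m (grad F T + (grad F T)^T) *m T =
  (1%:M - T) *m (grad G T + (grad G T)^T) *m T.
Proof.
move=> gT dF dG FG; have [TT TP _] := gT.
apply/eqP; rewrite -subr_eq0 -mulmxBl -mulmxBr; apply/eqP.
set D := (X in _ *m X *m _); apply: mx_eq0_bilinear => x y.
pose a := T *m x; pose b := (1%:M - T) *m y.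
have -> : y^T *m ((1%:M - T) *m D *m T) *m x = b^T *m D *m a.
  by rewrite /a /b trmx_mul [(_ - _)^T]linearB/= trmx1 TT !mulmxA.
have [->|a0] := eqVneq a 0; first by rewrite mulmx0.
have Ta : T *m a = a by rewrite mulmxA TP.
have Tb : T *m b = 0 by rewrite mulmxA mulmxBr mulmx1 TP subrr mul0mx.
have gr s : grass R N k (rotation T a b s).
  by apply: rotation_grass => //; exact: grass_projector gT.
have dd (H : 'M[R]_N -> R) : differentiable H T ->
    'D_1 (H \o rotation T a b) 0 = frob (grad H T) (velocity a b 0).
  move=> dH; have := @is_derive_along _ _ (rotation T a b) H 0 (velocity a b 0).
  rewrite rotation0 => /(_ dH (is_derive_rotation (grass_projector gT) Ta Tb a0 0)).
  by case.
have : frob (grad F T) (velocity a b 0) = frob (grad G T) (velocity a b 0).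
  rewrite -!dd//; suff -> : F \o rotation T a b = G \o rotation T a b by [].
  by apply/funext => s /=; exact: FG.
rewrite /velocity scale0r addr0 mulr0 !mul0r scale0r subr0.
have frobZr (A B : 'M[R]_N) c : frob A (c *: B) = c * frob A B.
  by rewrite /frob -scalemxAr linearZ.
have sa : (sqn a)^-1 != 0 by rewrite invr_eq0 sqn_eq0.
rewrite !frobZr => /(mulfI sa).
rewrite !frobDr !frob_outer => e.
apply/matrixP => i j; rewrite !ord1 [RHS]mxE.
have tr11 (A : 'M[R]_N) (p q : 'cV[R]_N) :
    (p^T *m A *m q) 0 0 = (q^T *m A^T *m p) 0 0.
  transitivity ((p^T *m A *m q)^T 0 0); first by rewrite [RHS]mxE.
  by rewrite !trmx_mul trmxK mulmxA.
rewrite /D !mulmxBr !mulmxBl !mulmxDr !mulmxDl.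
rewrite [LHS]mxE [X in X + _]mxE [X in _ + X]mxE [X in _ - X]mxE.
move: e; rewrite (tr11 (grad F T) a) (tr11 (grad G T) a) => ->.
by rewrite subrr.
Qed.

(** The hypothesis says that im Q lies in im P; as the traces agree, |P - Q|^2 = tr P - 2 tr (P Q) +
    tr Q vanishes. *)
Lemma grass_eq k P Q : grass R N k P -> grass R N k Q -> P *m Q = Q -> P = Q.
Proof.
move=> [PT PP tP] [QT QQ tQ] PQ; apply/eqP; rewrite -subr_eq0; apply/eqP.
apply: frob_eq0; rewrite /frob [(_ - _)^T]linearB/= PT QT mulmxBl !mulmxBr.
rewrite PP PQ QQ !linearB/= (mxtrace_mulC Q P) PQ tP tQ; ring.
Qed.

(** With t the angle between [x] and [x + y], this is 2 - 2 cos^2 t = 2 sin^2 t. *)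
Lemma line_dist (x y : 'cV[R]_N) : x != 0 -> y != 0 -> x^T *m y = 0 ->
  frobnorm (line (x + y) - line x) ^+ 2 = 2 * (sqn y / sqn (x + y)).
Proof.
move=> x0 y0 xy.
have yx : y^T *m x = 0 by rewrite -[LHS]trmxK trmx_mul trmxK xy trmx0.
have s : sqn (x + y) = sqn x + sqn y.
  by rewrite /sqn [(_ + _)^T]linearD/= mulmxDl !mulmxDr xy yx addr0 add0r mxE.
have s0 : 0 < sqn (x + y) by rewrite s addr_gt0 ?sqn_gt0.
have xy0 : x + y != 0 by rewrite -sqn_gt0.
have t : \tr (line (x + y) *m line x) = sqn x / sqn (x + y).
  rewrite mxtrace_mulC mul_line linearZ/= /line -!scalemxAl linearZ/=.
  have -> : x *m x^T *m (x + y) = sqn x *: x.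
    by rewrite -mulmxA mulmxDr xy addr0 mul_tr_sqn mul_mx_scalar.
  rewrite -scalemxAl linearZ/= mxtrace_mulC [(_ + _)^T]linearD/= mulmxDl yx addr0.
  by rewrite mul_tr_sqn mxtrace_scalar mulr1n; field; rewrite !lt0r_neq0// sqn_gt0.
rewrite sqr_frobnorm /frob [(_ - _)^T]linearB/= !line_tr mulmxBl !mulmxBr.
rewrite !line_idem// !linearB/= (mxtrace_mulC (line x)) t !line_trace// s.
by field; rewrite lt0r_neq0// -s.
Qed.

End grassmannian.

(** * Lipschitz bounds on the Grassmannian from pointwise bounds *)

Section lipschitz.
Context {R : realType} {N : nat}.
Implicit Types (Q S T : 'M[R]_N) (h : 'M[R]_N -> R).

Definition C1_bound k h (M : R) := forall X : 'M[R]_N, grass R N k X ->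
  [/\ differentiable h X, frobnorm (grad h X) <= M & `|h X| <= M].

(* One step of the path from [S] to [T]: a vector of im T orthogonal to the
   common part im Q is reached by rotating its orthogonal projection on im S. *)
Lemma rotation_step k q S T Q : grass R N k S -> grass R N k T ->
  grass R N q Q -> (q < k)%N -> T *m Q = Q -> S *m Q = Q ->
  frobnorm (T - S) <= 2^-1 ->
  exists S1 Q1 : 'M[R]_N, [/\ grass R N k S1 /\ grass R N q.+1 Q1, T *m Q1 = Q1,
    S1 *m Q1 = Q1, frobnorm (S1 - S) <= 2 * frobnorm (T - S) &
    forall h M, C1_bound k h M -> `|h S1 - h S| <= M * (8 * frobnorm (T - S))].
Proof.
move=> gS gT gQ qk TQ SQ; set e := frobnorm _ => e2.
have [ST SS tS] := gS; have [TT TP tT] := gT; have [QT QQ tQ] := gQ.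
have e0 : 0 <= e by exact: frobnorm_ge0.
(* The columns of [T - Q] lie in im T and are orthogonal to im Q. They do not all vanish, because
   the traces [k] and [q] differ; a nonzero one serves as [u]. *)
have [j] : exists j, col j (T - Q) != 0.
  apply: contrapT => /forallNP h; suff TQ0 : T = Q.
    by move: tT; rewrite TQ0 tQ => /eqP; rewrite eqr_nat ltn_eqF.
  apply/eqP; rewrite -subr_eq0; apply/eqP/matrixP => i j.
  have /negP := h j; rewrite negbK => /eqP/matrixP/(_ i 0).
  by rewrite !mxE.
set u := col _ _ => u0.
have QTQ : Q *m T = Q by rewrite -[LHS]trmxK trmx_mul TT QT TQ QT.
have QSQ : Q *m S = Q by rewrite -[LHS]trmxK trmx_mul ST QT SQ QT.
have Tu : T *m u = u by rewrite /u colE mulmxA mulmxBr TP TQ.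
have Qu : Q *m u = 0 by rewrite /u colE mulmxA mulmxBr QTQ QQ subrr mul0mx.
have [a aE] : {a | a = S *m u} by exists (S *m u).
have [b bE] : {b | b = u - a} by exists (u - a).
have uE : u = a + b by rewrite bE addrC subrK.
have Sa : S *m a = a by rewrite aE mulmxA SS.
have Sb : S *m b = 0 by rewrite bE mulmxBr Sa -aE subrr.
have Qa : Q *m a = 0 by rewrite aE mulmxA QSQ.
have pS := grass_projector gS.
have ab : a^T *m b = 0 by rewrite aE trmx_mul ST -mulmxA Sb mulmx0.
have su : sqn u = sqn a + sqn b.
  rewrite /sqn uE [(_ + _)^T]linearD/= mulmxDl !mulmxDr ab addr0.
  by rewrite -[b^T *m a]trmxK trmx_mul trmxK ab trmx0 add0r mxE.
(* As [u = T u], the remainder is [b = (T - S) u]. *)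
have sb : sqn b <= e ^+ 2 * sqn u.
  by rewrite bE aE -{1}Tu -mulmxBl; exact: frobnorm_mulcV.
have su0 : 0 < sqn u by rewrite sqn_gt0.
have e4 : e ^+ 2 <= 4^-1.
  by rewrite (_ : 4^-1 = 2^-1 ^+ 2); [rewrite ler_pXn2r// nnegrE|field].
(* Closeness of [S] and [T] keeps the projection [a] of [u] away from zero, so it can be rotated
   onto [u = a + b] by taking slope 1. *)
have sua : 3 / 4 * sqn u <= sqn a.
  have : e ^+ 2 * sqn u <= 4^-1 * sqn u by rewrite ler_wpM2r// ltW.
  lra.
have sa0 : 0 < sqn a by apply: lt_le_trans sua; rewrite mulr_gt0// divr_gt0.
have a0 : a != 0 by rewrite -sqn_gt0.
pose S1 := rotation S a b 1; pose Q1 := Q + line u.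
have S1E : S1 = S - line a + line u by rewrite /S1 /rotation scale1r -uE.
have gS1 : grass R N k S1 by exact: rotation_grass.
have lau : line a *m u = a.
  rewrite uE mulmxDr line_mul_self// /line -scalemxAl -mulmxA ab.
  by rewrite mulmx0 scaler0 addr0.
have S1u : S1 *m u = u.
  by rewrite S1E mulmxDl mulmxBl lau line_mul_self// -aE subrr add0r.
have S1Q : S1 *m Q = Q.
  rewrite S1E mulmxDl mulmxBl SQ !line_mul// Qa Qu !trmx0 !mulmx0 !scaler0.
  by rewrite subr0 addr0.
exists S1, Q1; split.
- split=> //; have [[? ?] t] := projector_add (grass_projector gQ) Qu u0.
  by split=> //; rewrite t tQ -natr1.
- by rewrite mulmxDr TQ mul_line Tu.
- by rewrite mulmxDr S1Q mul_line S1u.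
(* If [b = 0] the rotation is trivial; otherwise [line_dist] gives |S1 - S|^2 = 2 |b|^2 / |u|^2 <= 2
   e^2. *)
- have [b0|b0] := eqVneq b 0.
    rewrite S1E uE b0 addr0 subrK subrr.
    by rewrite /frobnorm /frob mulmx0 mxtrace0 sqrtr0 mulr_ge0.
  rewrite -(@ler_pXn2r _ 2)// ?nnegrE ?mulr_ge0 ?frobnorm_ge0//.
  rewrite S1E addrAC [S - _]addrC addrK addrC uE line_dist// -uE exprMn -natrX.
  have : sqn b / sqn u <= e ^+ 2 by rewrite ler_pdivrMr.
  by have := sqr_ge0 e; rewrite -/e; set x := e ^+ 2; set y := _ / _; lra.
- move=> h M hM; have M0 : 0 <= M.
    by have [_ hg _] := hM _ gS; apply: le_trans hg; exact: frobnorm_ge0.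
  apply: le_trans (rotation_increment pS Sa Sb a0 gS (M := M) _) _.
    by move=> X /hM[].
  (* It remains to see |b| <= 2 e |a|, which follows from |b|^2 <= e^2 |u|^2 and |u|^2 <= 4/3
     |a|^2. *)
  rewrite ler_wpM2l// (_ : 8 = 4 * 2); last by ring.
  rewrite -!mulrA ler_wpM2l// ler_pdivrMr ?sqrtr_gt0//.
  rewrite -(@ler_pXn2r _ 2)// ?nnegrE ?mulr_ge0 ?sqrtr_ge0//.
  rewrite !exprMn (sqr_sqrtr (sqn_ge0 a)) (sqr_sqrtr (sqn_ge0 b)).
  apply: le_trans sb _.
  have := sqr_ge0 e; have : e ^+ 2 * (3 / 4 * sqn u) <= e ^+ 2 * sqn a.
    by rewrite ler_wpM2l// sqr_ge0.
  by have := sqn_ge0 a; nra.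
Qed.

(** Induction on the number [j] of rotations left, the common part [Q] having trace [k - j]; for
    [j = 0] both projectors equal [Q]. A rotation moves [S] by at most twice its distance to [T], so
    that distance at most triples: hence the radius [d / 3] and the constant [8 + c * 3]. *)
Lemma lipschitz_near k j : (j <= k)%N ->
  exists2 c : R, 0 < c & exists2 d : R, 0 < d &
  forall S T Q h M, grass R N k S -> grass R N k T -> grass R N (k - j) Q ->
    T *m Q = Q -> S *m Q = Q -> C1_bound k h M -> frobnorm (T - S) <= d ->
    `|h T - h S| <= c * M * frobnorm (T - S).
Proof.
elim: j => [_|j IH jk].
  exists 1 => //; exists 1 => // S T Q h M gS gT; rewrite subn0 => gQ TQ SQ _ _.
  rewrite (grass_eq gT gQ TQ) (grass_eq gS gQ SQ) !subrr normr0.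
  by rewrite /frobnorm /frob mulmx0 mxtrace0 sqrtr0 mulr0.
have [c c0 [d d0 H]] := IH (ltnW jk).
exists (8 + c * 3); first by rewrite addr_gt0// mulr_gt0.
exists (Num.min 2^-1 (d / 3)); first by rewrite lt_min invr_gt0 ltr0n divr_gt0.
move=> S T Q h M gS gT gQ TQ SQ hM; rewrite le_min => /andP[e2 ed].
have qk : (k - j.+1 < k)%N by rewrite ltn_subrL// (leq_trans _ jk).
have [S1 [Q1 [[gS1 gQ1] TQ1 SQ1 SS1 hS]]] := rotation_step gS gT gQ qk TQ SQ e2.
rewrite subnSK// in gQ1.
have M0 : 0 <= M.
  by have [_ hg _] := hM _ gS; apply: le_trans hg; exact: frobnorm_ge0.
have T1 : frobnorm (T - S1) <= 3 * frobnorm (T - S).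
  have := frobnormB (T - S) (S1 - S); rewrite opprB addrA subrK; lra.
have /(H _ _ _ _ _ gS1 gT gQ1 TQ1 SQ1 hM) h1 : frobnorm (T - S1) <= d.
  by apply: le_trans T1 _; rewrite mulrC -ler_pdivlMr.
have := hS h M hM; have := ler_normD (h T - h S1) (h S1 - h S).
rewrite addrA subrK => h2 h3; apply: le_trans h2 _.
apply: le_trans (lerD h1 h3) _.
have : c * M * frobnorm (T - S1) <= c * M * (3 * frobnorm (T - S)).
  by rewrite ler_wpM2l// mulr_ge0// ltW.
lra.
Qed.

(** Nearby points are joined by rotations starting from the common part [0]. At distance at least
    [d], the increment is at most 2 M, which is at most (2 / d) M |T - S|. *)
Lemma lipschitz_grass k : exists2 c : R, 0 < c & forall S T h M,
  grass R N k S -> grass R N k T -> C1_bound k h M ->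
  `|h T - h S| <= c * M * frobnorm (T - S).
Proof.
have [c c0 [d d0 H]] := lipschitz_near (leqnn k).
exists (c + 2 / d) => [|S T h M gS gT hM]; first by rewrite addr_gt0// divr_gt0.
have M0 : 0 <= M.
  by have [_ hg _] := hM _ gS; apply: le_trans hg; exact: frobnorm_ge0.
have e0 : 0 <= frobnorm (T - S) by exact: frobnorm_ge0.
have [ed|/ltW de] := leP (frobnorm (T - S)) d.
  have g0 : grass R N (k - k) 0.
    by rewrite subnn; split; rewrite ?trmx0 ?mulmx0 ?mxtrace0.
  apply: le_trans (H _ _ _ _ _ gS gT g0 (mulmx0 _ _) (mulmx0 _ _) hM ed) _.
  by rewrite ler_wpM2r// ler_wpM2r// lerDl divr_ge0// ltW.
have [_ _ hS] := hM _ gS; have [_ _ hT] := hM _ gT.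
have := ler_normB (h T) (h S) => h1; apply: le_trans h1 _.
apply: (@le_trans _ _ (2 / d * M * d)).
  by rewrite (_ : 2 / d * M * d = M + M); [exact: lerD|field; rewrite lt0r_neq0].
apply: (@le_trans _ _ (2 / d * M * frobnorm (T - S))).
  by rewrite ler_wpM2l// mulr_ge0// divr_ge0// ltW.
by rewrite ler_wpM2r// ler_wpM2r// lerDr ltW.
Qed.

End lipschitz.

(** * The perturbed bilinear form *)

Section perturbation.
Context {R : realType} {N : nat}.
Implicit Types A B E U S T HS HT : 'M[R]_N.

Lemma frobZl (c : R) A B : frob (c *: A) B = c * frob A B.
Proof. by rewrite /frob [(_ *: _)^T]linearZ/= -scalemxAl linearZ. Qed.

Lemma frobZr (c : R) A B : frob A (c *: B) = c * frob A B.
Proof. by rewrite frobC frobZl frobC. Qed.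

Lemma frobNr A B : frob A (- B) = - frob A B.
Proof. by rewrite -scaleN1r frobZr mulN1r. Qed.

Lemma tr_perp A : A^T = A -> (1%:M - A)^T = 1%:M - A.
Proof. by move=> AT; rewrite linearB/= trmx1 AT. Qed.

(** Both sides equal k - tr (T S). *)
Lemma frob_dist k S T : grass R N k S -> grass R N k T ->
  frob T (1%:M - S) = 2^-1 * frobnorm (T - S) ^+ 2.
Proof.
move=> [ST SS tS] [TT TP tT]; rewrite sqr_frobnorm /frob [(T - S)^T]linearB/=.
rewrite ST TT mulmxBr mulmx1 mulmxBl !mulmxBr TP SS !linearB/= (mxtrace_mulC S).
by rewrite tS tT; field.
Qed.

(** The right-hand side is arranged so that every term is quadratic in [E] once [b - a] and
    [HT - HS] are of order [E]. Of the four pairings [p1] to [p4], only [p2] and [p3] are of first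
    order in [E]. *)
Lemma bilinear_expansion k S T HS HT (a b : R) :
  grass R N k S -> grass R N k T -> HT^T = HT ->
  let E := T - S in
  frob (a *: T + (1%:M - T) *m HT *m T)
    (b *: (1%:M - S) - S *m HS *m (1%:M - S)) =
  a * b / 2 * frobnorm E ^+ 2 +
  (b - a) * \tr ((1%:M - T) *m E *m (T *m HT)) +
  a * (\tr ((1%:M - S) *m E *m (E *m HT)) - \tr (E *m E *m (T *m HT)) +
       \tr ((1%:M - S) *m E *m (S *m (HT - HS)))) +
  \tr (HT *m ((1%:M - T) *m E) *m (HS *m ((1%:M - S) *m E))).
Proof.
move=> gS gT HTT E; have [ST SS tS] := gS; have [TT TP tT] := gT.
have US : (1%:M - S) *m S = 0 by rewrite mulmxBl mul1mx SS subrr.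
have VT : (1%:M - T) *m T = 0 by rewrite mulmxBl mul1mx TP subrr.
have p1 := frob_dist gS gT.
have UE : (1%:M - S) *m T = (1%:M - S) *m E by rewrite mulmxBr US subr0.
have VE : (1%:M - T) *m S = - ((1%:M - T) *m E) by rewrite mulmxBr VT sub0r opprK.
set U := 1%:M - S in US UE p1 *; set V := 1%:M - T in VT VE *.
have UT : U^T = U by exact: tr_perp.
have VTr : V^T = V by exact: tr_perp.
have U_E : U = 1%:M - S by [].
have V_E : V = 1%:M - T by [].
clearbody U V.
have p2 : frob T (S *m HS *m U) = \tr (U *m E *m (S *m HS)).
  by rewrite /frob TT !mulmxA mxtrace_mulC !mulmxA UE.
have p3 : frob (V *m HT *m T) U = \tr (V *m E *m (T *m HT)).
  rewrite /frob !trmx_mul HTT TT VTr !mulmxA -(mulmxA (T *m HT)) mxtrace_mulC.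
  rewrite !mulmxA; suff -> : V *m U *m T = V *m E *m T by [].
  by rewrite U_E /E !mulmxBr mulmx1 !mulmxBl -(mulmxA V T) TP.
have p4 : frob (V *m HT *m T) (S *m HS *m U) =
    - \tr (HT *m (V *m E) *m (HS *m (U *m E))).
  rewrite /frob !trmx_mul HTT TT VTr -!mulmxA mxtrace_mulC !mulmxA.
  rewrite -(mulmxA _ U T) UE -(mulmxA _ V S) VE mulmxN !mulNmx linearN/=.
  by rewrite !mulmxA.
have VU : V = U - E by rewrite V_E U_E /E opprB addrA addrNK.
(* The cancellation: replacing [T] by [S] in the first-order term costs only terms quadratic in
   [E]. *)
have p5 : \tr (V *m E *m (T *m HT)) = \tr (U *m E *m (S *m HT)) +
    \tr (U *m E *m (E *m HT)) - \tr (E *m E *m (T *m HT)).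
  have TE : T = S + E by rewrite /E addrC subrK.
  clearbody E; rewrite VU !mulmxBl [\tr (_ - _)]linearB/=; congr (_ - _).
  by rewrite {1}TE mulmxDl mulmxDr [\tr (_ + _)]linearD.
rewrite frobDl !frobDr !frobZl !frobZr !frobNr p1 p2 p3 p4.
rewrite (mulmxBr S) (mulmxBr (U *m E)) [\tr (_ - _)]linearB/=.
by rewrite (_ : \tr (U *m E *m (S *m HT)) = \tr (V *m E *m (T *m HT)) -
  \tr (U *m E *m (E *m HT)) + \tr (E *m E *m (T *m HT))); [field|rewrite p5; ring].
Qed.

(** Every term of the expansion after the first has absolute value at most a multiple of d e^2. The
    number [nu] bounds the norms of [S], [T] and their complements, and its summand 1 gives nu <=
    nu^2, so that all multiples are compared at degree two. *)
Lemma perturbation_bound k S T HS HT (a b d L : R) :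
  grass R N k S -> grass R N k T -> HT^T = HT ->
  let e := frobnorm (T - S) in
  let nu := N%:R + Num.sqrt N%:R + 1 in
  0 <= L -> 0 <= d -> d <= 4^-1 ->
  `|a - 1| <= d -> `|b - 1| <= d -> `|b - a| <= L * d * e ->
  frobnorm HS <= 2 * d -> frobnorm HT <= 2 * d ->
  frobnorm (HT - HS) <= L * d * e ->
  (4^-1 - d * (4 * L * nu ^+ 2 + 12 * nu ^+ 2)) * e ^+ 2 <=
  frob (a *: T + (1%:M - T) *m HT *m T)
    (b *: (1%:M - S) - S *m HS *m (1%:M - S)).
Proof.
move=> gS gT HTT e nu L0 d0 d4 a1 b1 ba hS hT hTS.
rewrite (bilinear_expansion HS a b gS gT HTT) -/e.
have N0 : 0 <= (N%:R : R) by [].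
have sN0 : 0 <= Num.sqrt (N%:R : R) by exact: sqrtr_ge0.
have nu1 : 1 <= nu by rewrite /nu; lra.
have nu0 : 0 <= nu by lra.
have e0 : 0 <= e by exact: frobnorm_ge0.
have nS : frobnorm S <= nu by have := grass_frobnorm gS; rewrite /nu; lra.
have nT : frobnorm T <= nu by have := grass_frobnorm gT; rewrite /nu; lra.
have n1 : frobnorm (1%:M : 'M[R]_N) = Num.sqrt N%:R.
  by rewrite /frobnorm /frob trmx1 mulmx1 mxtrace1.
have nU : frobnorm (1%:M - S) <= nu.
  have := frobnormB 1%:M S; have := grass_frobnorm gS; rewrite n1 /nu; lra.
have nV : frobnorm (1%:M - T) <= nu.
  have := frobnormB 1%:M T; have := grass_frobnorm gT; rewrite n1 /nu; lra.
have mulle (A B : 'M[R]_N) x y : frobnorm A <= x -> frobnorm B <= y ->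
    frobnorm (A *m B) <= x * y.
  move=> hA hB; apply: le_trans (frobnormM _ _) _.
  by apply: ler_pM => //; exact: frobnorm_ge0.
have trle (A B : 'M[R]_N) x y : frobnorm A <= x -> frobnorm B <= y ->
    `|\tr (A *m B)| <= x * y.
  move=> hA hB; apply: le_trans (mxtrace_mul_le _ _) _.
  by apply: ler_pM => //; exact: frobnorm_ge0.
have ee : frobnorm (T - S) <= e by [].
have t1 := trle _ _ _ _ (mulle _ _ _ _ nV ee) (mulle _ _ _ _ nT hT).
have t2 := trle _ _ _ _ (mulle _ _ _ _ nU ee) (mulle _ _ _ _ ee hT).
have t3 := trle _ _ _ _ (mulle _ _ _ _ ee ee) (mulle _ _ _ _ nT hT).
have t4 := trle _ _ _ _ (mulle _ _ _ _ nU ee) (mulle _ _ _ _ nS hTS).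
have t5 := trle _ _ _ _ (mulle _ _ _ _ hT (mulle _ _ _ _ nV ee))
  (mulle _ _ _ _ hS (mulle _ _ _ _ nU ee)).
move: t1 t2 t3 t4 t5; rewrite /=.
set x1 := \tr _; set x2 := \tr _; set x3 := \tr _; set x4 := \tr _; set x5 := \tr _.
move=> t1 t2 t3 t4 t5.
(* Both factors are at least 3/4, and 9/32 exceeds 1/4. *)
have ab : 4^-1 <= a * b / 2.
  move: a1 b1; rewrite !ler_norml => /andP[? ?] /andP[? ?]; nra.
have a2 : `|a| <= 2 by move: a1; rewrite !ler_norml => /andP[? ?]; apply/andP; lra.
have q1 : `|(b - a) * x1| <= L * d * e * (nu * e * (nu * (2 * d))).
  by rewrite normrM ler_pM.
have q2 : `|a * (x2 - x3 + x4)| <= 2 * (nu * e * (e * (2 * d)) +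
    e * e * (nu * (2 * d)) + nu * e * (nu * (L * d * e))).
  rewrite normrM ler_pM//; apply: le_trans (ler_normD _ _) _.
  rewrite lerD//; apply: le_trans (ler_normB _ _) _; exact: lerD.
have p : 4^-1 * e ^+ 2 <= a * b / 2 * e ^+ 2 by rewrite ler_wpM2r// sqr_ge0.
have s : L * d * e * (nu * e * (nu * (2 * d))) + 2 * (nu * e * (e * (2 * d)) +
    e * e * (nu * (2 * d)) + nu * e * (nu * (L * d * e))) +
    2 * d * (nu * e) * (2 * d * (nu * e)) <=
    d * (4 * L * nu ^+ 2 + 12 * nu ^+ 2) * e ^+ 2.
  have de : 0 <= d * e ^+ 2 by rewrite mulr_ge0// sqr_ge0.
  rewrite (_ : _ + _ + _ = (d * e ^+ 2) * (2 * d * L * nu ^+ 2 +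
    (8 * nu + 2 * nu ^+ 2 * L) + 4 * d * nu ^+ 2)); last by ring.
  rewrite [leRHS](_ : _ =
    (d * e ^+ 2) * (4 * L * nu ^+ 2 + 12 * nu ^+ 2)); last by ring.
  apply: ler_wpM2l => //.
  have nn : nu <= nu ^+ 2 by rewrite expr2 ler_peMl.
  have Ln : 0 <= L * nu ^+ 2 by rewrite mulr_ge0// sqr_ge0.
  have : d * (L * nu ^+ 2) <= 4^-1 * (L * nu ^+ 2) by rewrite ler_wpM2r.
  have : d * nu ^+ 2 <= 4^-1 * nu ^+ 2 by rewrite ler_wpM2r// sqr_ge0.
  lra.
move: q1 q2 t5; rewrite !ler_norml => /andP[q1 _] /andP[q2 _] /andP[q5 _].
rewrite mulrBl; lra.
Qed.

End perturbation.

(** * Extensions and duality *)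

Section extensions.
Context {R : realType} {N k : nat}.
Implicit Types (Psi : Gr R N k -> R) (F G : 'M[R]_N -> R) (X : 'M[R]_N).

Lemma GrP (T : Gr R N k) : grass R N k T.
Proof. exact: set_valP. Qed.

Lemma Gr_inj (T S : Gr R N k) : (T : 'M[R]_N) = S -> T = S.
Proof. exact: val_inj. Qed.

Lemma perpE l (h : (k + l)%N = N) (T : Gr R N k) :
  (perp h T : 'M[R]_N) = 1%:M - (T : 'M[R]_N).
Proof. by []. Qed.

Lemma Gr_ind (P : 'M[R]_N -> Prop) :
  (forall T : Gr R N k, P T) -> forall X, grass R N k X -> P X.
Proof. by move=> h X gX; have := h (exist _ X (mem_set gX)). Qed.

Lemma C1_extension_xget Psi : C1_Gr Psi ->
  C1_extension Psi (xget (fun=> 0) (C1_extension Psi)).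
Proof. by move=> [F hF]; exact: xgetPex (ex_intro _ F hF). Qed.

Lemma C1_extension_diff Psi F : C1_extension Psi F ->
  forall X, grass R N k X -> differentiable F X.
Proof. by move=> [_ [U [_ gU hU]]] X /gU /hU[]. Qed.

Lemma C2_Gr_C1 Psi : C2_Gr Psi -> C1_Gr Psi.
Proof. by move=> [F [FP [U [oU gU [C1 _]]]]]; exists F; split=> //; exists U. Qed.

(** Frees [B_] from the chosen extension: it may be computed with any [F] that agrees with [Psi] on
    the Grassmannian and is differentiable at [T]. *)
Lemma tangential_d Psi F (T : Gr R N k) :
  C1_Gr Psi -> differentiable F (T : 'M[R]_N) ->
  (forall S : Gr R N k, F S = Psi S) ->
  (1%:M - (T : 'M[R]_N)) *m d_ Psi T *m T =
  (1%:M - (T : 'M[R]_N)) *m (grad F T + (grad F T)^T) *m T.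
Proof.
move=> hPsi dF FP; have hG := C1_extension_xget hPsi.
apply: (tangential_grad_unique (GrP T)) => //.
  exact: C1_extension_diff hG _ (GrP T).
by apply: Gr_ind => S; rewrite FP; case: hG.
Qed.

Lemma diff_grad_eq F G X : differentiable F X -> differentiable G X ->
  (forall V, 'd F X V = 'd G X V) -> grad F X = grad G X.
Proof.
by move=> dF dG h; apply/matrixP => i j; rewrite !mxE /partial !deriveE// h.
Qed.

Lemma grad_addl (c : R) F X : differentiable F X ->
  differentiable (fun Y => c + F Y) X /\ grad (fun Y => c + F Y) X = grad F X.
Proof.
move=> dF; have dc : differentiable (fun Y => c + F Y) X.
  exact: differentiableD (differentiable_cst _ _) dF.
split=> //; apply: (diff_grad_eq dc dF) => V.
have /(congr1 (fun f => f V)) := diffD (differentiable_cst c X) dF.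
by rewrite diff_cst /= add0r.
Qed.

Lemma grad_reflect F X : differentiable F (1%:M - X) ->
  differentiable (fun Y => F (1%:M - Y)) X /\
  grad (fun Y => F (1%:M - Y)) X = - grad F (1%:M - X).
Proof.
move=> dF.
pose r (Y : 'M[R]_N) : 'M[R]_N := 1%:M - Y.
have dr : differentiable r X.
  exact: differentiableB (differentiable_cst _ _) _.
have dc : differentiable (F \o r) X by exact: (differentiable_comp dr dF).
split=> //; apply/matrixP => i j; rewrite /grad !mxE /partial.
rewrite (deriveE (delta_mx i j) dc) (deriveE (delta_mx i j) dF).
have rV V : 'd r X V = - V.
  have [di idE] : is_diff X (id : 'M[R]_N -> 'M[R]_N) id by exact: is_diff_id.
  have e := diffB (differentiable_cst (1%:M : 'M[R]_N) X) di.
  have c0 := diff_cst (1%:M : 'M[R]_N) X.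
  pose at_V (f : 'M[R]_N -> 'M[R]_N) := f V.
  have c := f_equal2 (fun x y => x - y) (congr1 at_V c0) (congr1 at_V idE).
  exact: etrans (congr1 at_V e) (etrans c (sub0r V)).
have /(congr1 (fun f => f (delta_mx i j))) := diff_comp dr dF.
move=> /= e; apply: (etrans e); rewrite -[RHS]linearN.
exact: (congr1 ('d F (r X)) (rV _)).
Qed.

End extensions.

Section dual.
Context {R : realType} {m n : nat}.
Implicit Types (Psi : Gr R (m + n) m -> R).

Lemma C1_Gr_dual Psi : C1_Gr Psi -> C1_Gr (dual Psi).
Proof.
move=> [F [FP [U [oU gU hU]]]].
pose r (Y : 'M[R]_(m + n)) : 'M[R]_(m + n) := 1%:M - Y.
have rc : continuous r.
  by move=> X; apply: (@cvgB _ _ _ (nbhs X)); [exact: cvg_cst|exact: cvg_id].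
exists (F \o r); split.
  by move=> T; rewrite /dual -FP.
exists (r @^-1` U); split.
- by apply: open_comp => // X _; exact: rc.
- apply: Gr_ind => P; exact: gU (GrP (perp (addnC n m) P)).
- move=> X UX; have [dF cF] := hU (r X) UX.
  have [d gX] := @grad_reflect _ _ F X dF; split; first exact: d.
  (* The formula for the gradient of the reflected function holds on the preimage of [U] only, so
     continuity is transferred through a neighborhood of [X]. *)
  have e : \forall Y \near X, - grad F (r Y) = grad (F \o r) Y.
    near=> Y; have UY : U (r Y).
      near: Y; apply: rc; exact: open_nbhs_nbhs.
    have [dY _] := hU (r Y) UY.
    by have [_ gY] := @grad_reflect _ _ F Y dY; exact: esym gY.
  apply: cvg_trans (near_eq_cvg e) _.
  have gX' : grad (F \o r) X = - grad F (r X) by exact: gX.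
  rewrite gX'; apply: (@cvgN _ _ _ (nbhs X)).
  exact: (cvg_comp _ _ (rc X) cF).
Unshelve. all: by end_near. Qed.

Lemma dual_perp Psi (S : Gr R (m + n) m) :
  dual Psi (perp (erefl (m + n)%N) S) = Psi S.
Proof.
by rewrite /dual; congr Psi; apply: Gr_inj; rewrite !perpE opprB addrC subrK.
Qed.

(** Adding the constant 1 does not change the gradient, while the reflection behind the dual changes
    its sign. Hence the same [H] occurs in both formulas, with opposite signs, as
    [perturbation_bound] requires. *)
Lemma B_perturbation Psi (F : 'M[R]_(m + n) -> R) (T : Gr R (m + n) m) :
  C1_Gr Psi -> (forall X, grass R (m + n) m X -> differentiable F X) ->
  (forall S : Gr R (m + n) m, F S = Psi S - 1) ->
  let H := grad F T + (grad F T)^T in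
  B_ Psi T = (1 + F T) *: (T : 'M[R]_(m + n)) +
    (1%:M - (T : 'M[R]_(m + n))) *m H *m T /\
  B_ (dual Psi) (perp (erefl (m + n)%N) T) =
    (1 + F T) *: (1%:M - (T : 'M[R]_(m + n))) -
    T *m H *m (1%:M - (T : 'M[R]_(m + n))).
Proof.
move=> hPsi dF FP H; have dFT := dF _ (GrP T).
have FT : 1 + F T = Psi T by rewrite FP addrC subrK.
split.
  have [d g] := grad_addl 1 dFT.
  rewrite /B_ FT (tangential_d hPsi d) ?g// => S.
  by rewrite FP addrC subrK.
have hD := C1_Gr_dual hPsi.
have TE : 1%:M - (perp (erefl (m + n)%N) T : 'M[R]_(m + n)) = T.
  by rewrite perpE opprB addrC subrK.
have dFT' := dFT; rewrite -TE in dFT'.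
have [d1 g1] := grad_reflect dFT'; have [d2 g2] := grad_addl 1 d1.
rewrite /B_ (tangential_d hD d2) => [|S].
  rewrite g2 g1 dual_perp FT TE -FT /H linearN/= -opprD mulmxN mulNmx.
  by rewrite FT.
rewrite /dual (_ : _ - _ = mx_of_Gr (perp (addnC n m) S))// FP.
by rewrite addrC subrK.
Qed.

End dual.

(** Each supremum is nonnegative, so each is bounded by the sum of the three; this is valid before
    they are known to be finite. *)
Lemma sup_add3_le (R : realType) (T : Type) (G : set T) (f g h : T -> R)
  (d : R) (x : T) :
  (forall y, 0 <= f y) -> (forall y, 0 <= g y) -> (forall y, 0 <= h y) -> G x ->
  (ereal_sup [set (f y)%:E | y in G] + ereal_sup [set (g y)%:E | y in G] +
   ereal_sup [set (h y)%:E | y in G] <= d%:E)%E ->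
  [/\ f x <= d, g x <= d & h x <= d].
Proof.
move=> f0 g0 h0 Gx.
have ub (u : T -> R) : ((u x)%:E <= ereal_sup [set (u y)%:E | y in G])%E.
  by apply: ereal_sup_ubound; exists x.
have ge0 (u : T -> R) : (forall y, 0 <= u y) ->
    (0 <= ereal_sup [set (u y)%:E | y in G])%E.
  by move=> u0; apply: le_trans (ub u); rewrite lee_fin.
move=> H; split; rewrite -lee_fin; apply: le_trans (ub _) (le_trans _ H).
- by rewrite -addeA leeDl// adde_ge0// ge0.
- by rewrite addeAC leeDr// adde_ge0// ge0.
- by rewrite leeDr// adde_ge0// ge0.
Qed.

(** * The condition (USAC) for integrands close to 1 *)

Section near_one.
Context {R : realType}.

Lemma le_sum2 (I J : finType) (f : I -> J -> R) i j :
  (forall i j, 0 <= f i j) -> f i j <= \sum_i \sum_j f i j.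
Proof.
move=> f0; rewrite (bigD1 i)//= (bigD1 j)//= -addrA lerDl.
by apply: addr_ge0; apply: sumr_ge0 => // k _; apply: sumr_ge0.
Qed.

Lemma grad_partial_le N (F : 'M[R]_N -> R) X i j :
  frobnorm (grad (partial i j F) X) <= hessnorm F X.
Proof.
have h := @le_sum2 _ _ (fun i j => frobnorm (grad (partial i j F) X) ^+ 2) i j
  (fun _ _ => sqr_ge0 _).
rewrite /hessnorm -[leLHS]ger0_norm ?frobnorm_ge0// -sqrtr_sqr.
exact: ler_wsqrtr.
Qed.

(** Makes [lipschitz_grass] applicable to [F] and to each entry of its gradient; the gradients of
    those entries are controlled by the Hessian. *)
Lemma C1_bounds N k (F : 'M[R]_N -> R) (U : set 'M[R]_N) (d : R) :
  grass R N k `<=` U -> C2_on U F -> (ext_C2norm k F <= d%:E)%E ->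
  [/\ C1_bound k F d, forall i j, C1_bound k (partial i j F) d &
      forall X, grass R N k X -> frobnorm (grad F X) <= d].
Proof.
move=> gU [F1 F2] Fd.
have b X : grass R N k X ->
    [/\ `|F X| <= d, frobnorm (grad F X) <= d & hessnorm F X <= d].
  move=> gX; apply: (@sup_add3_le _ _ (grass R N k) (fun X => `|F X|)
    (fun X => frobnorm (grad F X)) (hessnorm F) d X) => //.
  - by move=> Y; exact: frobnorm_ge0.
  - by move=> Y; exact: sqrtr_ge0.
split=> [X gX|i j X gX|X gX].
- by have [? ? ?] := b X gX; split=> //; have [] := F1 _ (gU _ gX).
- have [? g h] := b X gX; split.
  + by have [] := F2 i j _ (gU _ gX).
  + exact: le_trans (grad_partial_le _ _ _ _) h.
  + apply: le_trans g; have := entry_le (grad F X) i j.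
    by rewrite /grad mxE.
- by have [] := b X gX.
Qed.

Lemma usac_near_one (m n : nat) : exists2 eps : R, 0 < eps &
  forall Psi : Gr R (m + n) m -> R,
    C2_Gr Psi -> (C2norm (fun T => (Psi T - 1)%R) <= eps%:E)%E ->
    uniform_scalar_atomic_condition Psi.
Proof.
set N := (m + n)%N.
have [c c0 lip] := @lipschitz_grass R N m.
pose nu : R := N%:R + Num.sqrt N%:R + 1.
(* The 1 accounts for [F], and 2 N for the symmetrized gradient: the [N ^ 2] entries have Lipschitz
   constant [c * d], so the gradient has [N * c * d], and adding the transpose doubles it. *)
pose L : R := c * (1 + 2 * N%:R).
pose K : R := 4 * L * nu ^+ 2 + 12 * nu ^+ 2.
have L0 : 0 <= L by rewrite mulr_ge0 ?ltW// addr_ge0// mulr_ge0.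
have cL : c <= L.
  by rewrite /L mulrDr mulr1 lerDl mulr_ge0 ?(ltW c0)// mulr_ge0.
have K0 : 0 <= K.
  by have n2 := sqr_ge0 nu; have := mulr_ge0 L0 n2; rewrite /K; lra.
(* Chosen so that [d * K <= 8^-1]: of the coefficient 1/4 in [perturbation_bound] there remains 1/8,
   the constant of (USAC). *)
pose d : R := (8 * (K + 1))^-1.
have K1 : 0 < 8 * (K + 1) by rewrite mulr_gt0// ltr_wpDl.
have d0 : 0 < d by rewrite invr_gt0.
have dK : d * K <= 8^-1.
  rewrite /d mulrC ler_pdivrMr// mulrA mulVf ?mul1r ?lerDl//.
have d4 : d <= 4^-1.
  rewrite lef_pV2 ?posrE//; lra.
(* The infimum defining [C2norm] need not be attained; halving [d] leaves room for an extension of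
   norm below [d]. *)
clearbody d; exists (d / 2); first by rewrite divr_gt0.
move=> Psi hPsi /le_lt_trans normPsi.
have /normPsi : ((d / 2)%:E < d%:E)%E by rewrite lte_fin; lra.
move=> /ereal_inf_lt[_ [F [FP [U [oU gU hF]]] <-]] /ltW Fd.
have [b0 b1 b2] := C1_bounds gU hF Fd.
have dF X : grass R N m X -> differentiable F X by move=> /b0[].
exists 8^-1; first by rewrite invr_gt0.
move=> T S _.
have [BT _] := B_perturbation T (C2_Gr_C1 hPsi) dF FP.
have [_ BS] := B_perturbation S (C2_Gr_C1 hPsi) dF FP.
rewrite BT BS.
have gT := GrP T; have gS := GrP S.
have [_ _ FT] := b0 _ gT; have [_ _ FS] := b0 _ gS.
have e0 : 0 <= frobnorm ((T : 'M[R]_N) - (S : 'M[R]_N)) by exact: frobnorm_ge0.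
have cd0 : 0 <= c * d by exact: mulr_ge0 (ltW c0) (ltW d0).
have lF := lip _ _ _ _ gS gT b0.
have lG : frobnorm (grad F T - grad F S) <=
    N%:R * (c * d * frobnorm ((T : 'M[R]_N) - (S : 'M[R]_N))).
  apply: frobnorm_le_entries => [|i j]; first exact: mulr_ge0 cd0 e0.
  have := lip _ _ _ _ gS gT (b1 i j).
  by rewrite /grad !mxE.
have hH X : grass R N m X -> frobnorm (grad F X + (grad F X)^T) <= 2 * d.
  move=> gX; apply: le_trans (frobnormD _ _) _; rewrite frobnorm_tr.
  by have := b2 _ gX; lra.
have := @perturbation_bound _ _ _ (S : 'M[R]_N) T
  (grad F S + (grad F S)^T) (grad F T + (grad F T)^T) (1 + F T) (1 + F S) d L gS gT.
move=> H; apply: le_trans (H _ L0 (ltW d0) d4 _ _ _ (hH _ gS) (hH _ gT) _).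
- rewrite -/N -/nu -/K ler_wpM2r ?sqr_ge0//.
  by rewrite -/nu -/K; lra.
- by rewrite linearD/= trmxK addrC.
- by rewrite addrC addKr.
- by rewrite addrC addKr.
- rewrite opprD addrACA subrr add0r distrC; apply: le_trans lF _.
  exact: ler_wpM2r e0 _ _ (ler_wpM2r (ltW d0) cL).
- rewrite (_ : _ - _ = (grad F T - grad F S) + (grad F T - grad F S)^T); last first.
    by rewrite [(_ - _)^T]linearB/= opprD addrACA.
  apply: le_trans (frobnormD _ _) _; rewrite frobnorm_tr.
  set e := frobnorm _ in e0 lG *.
  apply: le_trans (lerD lG lG) _.
  have := mulr_ge0 cd0 e0.
  rewrite /L; lra.
Qed.

End near_one.

(** * Topology of matrices *)

Section matrix_topology.
Context {R : realType}.

Lemma cvg_mx (T : Type) (F : set_system T) (m n : nat) (f : T -> 'M[R]_(m, n))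
  (A : 'M[R]_(m, n)) : Filter F ->
  (forall i j, f x i j @[x --> F] --> A i j) -> f x @[x --> F] --> A.
Proof.
move=> FF h; apply/cvgrPdist_le => /= e e0; near=> x.
rewrite /Num.Def.normr/= mx_normrE (bigmax_le _ (ltW e0))//= => i _.
rewrite !mxE; move: i; near: x; apply: filter_forall => /= i.
by have /cvgrPdist_le/(_ e e0) := h i.1 i.2.
Unshelve. all: by end_near. Qed.

Lemma cvg_entry (T : Type) (F : set_system T) (m n : nat) (f : T -> 'M[R]_(m, n))
  (A : 'M[R]_(m, n)) i j : Filter F ->
  f x @[x --> F] --> A -> f x i j @[x --> F] --> A i j.
Proof. by move=> FF h; exact: (cvg_comp _ _ h (@coord_continuous R m n i j A)). Qed.

Lemma cvg_sum_fin (T : Type) (F : set_system T) (I : finType) (f : I -> T -> R)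
  (a : I -> R) : Filter F -> (forall i, f i x @[x --> F] --> a i) ->
  \sum_i f i x @[x --> F] --> \sum_i a i.
Proof. by move=> FF h; apply: cvg_big => //; exact: add_continuous. Qed.

Lemma cvg_mulmx (T : Type) (F : set_system T) (m n p : nat)
  (f : T -> 'M[R]_(m, n)) (g : T -> 'M[R]_(n, p)) (A : 'M[R]_(m, n))
  (B : 'M[R]_(n, p)) : Filter F ->
  f x @[x --> F] --> A -> g x @[x --> F] --> B ->
  f x *m g x @[x --> F] --> A *m B.
Proof.
move=> FF fA gB; apply: cvg_mx => i j; rewrite mxE.
under eq_fun do rewrite mxE.
apply: cvg_sum_fin => k; apply: cvgM; exact: cvg_entry.
Qed.

Lemma cvg_trmx (T : Type) (F : set_system T) (m n : nat)
  (f : T -> 'M[R]_(m, n)) (A : 'M[R]_(m, n)) : Filter F ->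
  f x @[x --> F] --> A -> (f x)^T @[x --> F] --> A^T.
Proof.
move=> FF fA; apply: cvg_mx => i j; rewrite mxE.
by under eq_fun do rewrite mxE; exact: cvg_entry.
Qed.

Lemma cvg_mxtrace (T : Type) (F : set_system T) (n : nat)
  (f : T -> 'M[R]_n) (A : 'M[R]_n) : Filter F ->
  f x @[x --> F] --> A -> \tr (f x) @[x --> F] --> \tr A.
Proof. by move=> FF fA; apply: cvg_sum_fin => k; exact: cvg_entry. Qed.

Lemma cvg_frob (T : Type) (F : set_system T) (n : nat)
  (f g : T -> 'M[R]_n) (A B : 'M[R]_n) : Filter F ->
  f x @[x --> F] --> A -> g x @[x --> F] --> B ->
  frob (f x) (g x) @[x --> F] --> frob A B.
Proof.
by move=> FF fA gB; apply: cvg_mxtrace; apply: cvg_mulmx => //; exact: cvg_trmx.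
Qed.

Lemma vec_mx_continuous (m n : nat) : continuous (@vec_mx R m n).
Proof.
move=> v; apply: (@cvg_mx _ (nbhs v) _ _ vec_mx _ (nbhs_filter v)) => i j.
rewrite mxE.
by under eq_fun do rewrite mxE; exact: coord_continuous.
Qed.

(** A continuous sum of squares that vanishes exactly on the Grassmannian, which is therefore
    closed. *)
Definition defect N k (X : 'M[R]_N) : R :=
  frob (X^T - X) (X^T - X) + frob (X *m X - X) (X *m X - X) +
  (\tr X - k%:R) ^+ 2.

Lemma defect_eq0 N k (X : 'M[R]_N) : defect k X = 0 <-> grass R N k X.
Proof.
split => [|[Xt XX tX]]; last first.
  by rewrite /defect Xt XX tX !subrr /frob !mulmx0 mxtrace0 expr0n !addr0.
move=> h; have h1 := frob_ge0 (X^T - X); have h2 := frob_ge0 (X *m X - X).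
have h3 := sqr_ge0 (\tr X - k%:R); rewrite /defect in h.
have e1 : frob (X^T - X) (X^T - X) = 0 by lra.
have e2 : frob (X *m X - X) (X *m X - X) = 0 by lra.
have /eqP e3 : (\tr X - k%:R) ^+ 2 = 0 by lra.
split; apply/eqP; rewrite -subr_eq0.
- exact/eqP/frob_eq0.
- exact/eqP/frob_eq0.
- by rewrite sqrf_eq0 in e3.
Qed.

Lemma defect_continuous N k : continuous (@defect N k).
Proof.
move=> X.
have cX : id Y @[Y --> X] --> X by exact: cvg_id.
have c1 : (Y : 'M[R]_N)^T - Y @[Y --> X] --> X^T - X.
  by apply: (@cvgB _ _ _ (nbhs X)) => //; exact: cvg_trmx.
have c2 : (Y : 'M[R]_N) *m Y - Y @[Y --> X] --> X *m X - X.
  by apply: (@cvgB _ _ _ (nbhs X)) => //; exact: cvg_mulmx.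
apply: (@cvgD _ _ _ (nbhs X)).
  by apply: (@cvgD _ _ _ (nbhs X)); exact: cvg_frob.
have c3 : \tr (Y : 'M[R]_N) - k%:R @[Y --> X] --> \tr X - k%:R.
  by apply: (@cvgB _ _ _ (nbhs X)); [exact: cvg_mxtrace|exact: cvg_cst].
by under eq_fun do rewrite expr2; rewrite expr2; exact: cvgM.
Qed.

(** Compactness: flattened into row vectors, the Grassmannian is bounded by [grass_frobnorm] and
    closed as the zero set of [defect]. *)
Lemma grass_bounded N k (f : 'M[R]_N -> R) :
  (forall X, grass R N k X -> {for X, continuous f}) ->
  exists M, forall X, grass R N k X -> `|f X| <= M.
Proof.
move=> cf; pose V : set 'rV[R]_(N * N) := vec_mx @^-1` grass R N k.
have cV : compact V.
  apply: bounded_closed_compact.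
    exists N%:R; split => //= x Nx v Vv; apply: le_trans (ltW Nx).
    rewrite /Num.Def.normr/= mx_normrE bigmax_le// => -[i j] _ /=.
    rewrite ord1; case/mxvec_indexP: j => i1 j1.
    have := entry_le (vec_mx v) i1 j1; rewrite mxE => /le_trans; apply.
    exact: grass_frobnorm Vv.
  rewrite (_ : V = (defect k \o vec_mx) @^-1` [set x | x = 0]); last first.
    by apply/seteqP; split=> v; rewrite /V /= defect_eq0.
  apply: closed_comp; last exact: closed_eq.
  move=> v _; apply: continuous_comp; first exact: vec_mx_continuous.
  exact: defect_continuous.
have /compact_bounded[M [_ hM]] : compact ((f \o vec_mx) @` V).
  apply: continuous_compact cV; apply/subspace_continuousP => v Vv.
  apply: cvg_within_filter.
  apply: (cvg_comp _ _ (@vec_mx_continuous _ _ v)); exact: cf.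
(* [compact_bounded] provides as bounds the numbers strictly above [M]. *)
exists (M + 1) => X gX; apply: (hM (M + 1)); first by rewrite ltrDl.
by exists (mxvec X); rewrite /V/= mxvecK.
Qed.

End matrix_topology.

(** * The atomic condition *)

Section kernel.
Context {R : realType}.

(** Induction on [k]: a kernel vector outside im P, projected orthogonally to im P, stays in the
    kernel because [A *m P = 0], and its line is added to [P]. *)
Lemma kernel_projector N (A : 'M[R]_N) k : (k <= dimker A)%N ->
  exists2 P, grass R N k P & A *m P = 0.
Proof.
elim: k => [_|k IH kA].
  by exists 0; rewrite ?mulmx0//; split; rewrite ?trmx0 ?mulmx0 ?mxtrace0.
have [P gP AP] := IH (ltnW kA); have [PT PP tP] := gP.
have rP : \rank P = k.
  by apply/eqP; rewrite -(eqr_nat R) -idempotent_trace// tP.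
(* Were all rows of [kermx A^T] fixed by [P], the kernel would have dimension at most the rank [k]
   of [P]. *)
have [i wi] : exists i, row i (kermx A^T *m (1%:M - P)) != 0.
  apply: contrapT => /forallNP h; move: kA; rewrite ltnNge => /negP; apply.
  suff e : kermx A^T = kermx A^T *m P by rewrite /dimker e -[leqRHS]rP mxrankM_maxr.
  apply/eqP; rewrite -subr_eq0 -{1}(mulmx1 (kermx _)) -mulmxBr.
  apply/eqP/row_matrixP => i; rewrite row0.
  by have /negP := h i; rewrite negbK => /eqP.
pose w := row i (kermx A^T).
have wA : w *m A^T = 0 by rewrite /w -row_mul mulmx_ker row0.
pose a := (1%:M - P) *m w^T.
have aE : a = (row i (kermx A^T *m (1%:M - P)))^T.
  by rewrite row_mul -/w trmx_mul tr_perp.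
have a0 : a != 0.
  by apply: contra wi => /eqP e; rewrite -[row _ _]trmxK -aE e trmx0.
have Pa : P *m a = 0 by rewrite mulmxA mulmxBr mulmx1 PP subrr mul0mx.
have Aa : A *m a = 0.
  rewrite /a mulmxA mulmxBr AP subr0 mulmx1 -[A]trmxK -trmx_mul wA.
  by rewrite trmx0.
have [[Qt QQ] tQ] := projector_add (grass_projector gP) Pa a0.
exists (P + line a); first by split => //; rewrite tQ tP -natr1.
by rewrite mulmxDr AP add0r mul_line Aa mul0mx scaler0.
Qed.

(** By cyclicity the trace contains the factor [P *m A^T], the transpose of [A *m P]. *)
Lemma frob_kernel N (A K P : 'M[R]_N) : P^T = P -> A *m P = 0 ->
  frob A (K *m P) = 0.
Proof.
move=> PT AP; rewrite /frob mulmxA mxtrace_mulC mulmxA.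
by rewrite -{1}PT -trmx_mul AP trmx0 mul0mx mxtrace0.
Qed.

Lemma B_factor N k (Psi : Gr R N k -> R) (T : Gr R N k) :
  exists K, B_ Psi T = K *m (T : 'M[R]_N).
Proof.
exists ((Psi T)%:M + (1%:M - (T : 'M[R]_N)) *m d_ Psi T).
by rewrite (mulmxDl (Psi T)%:M) (mul_scalar_mx (Psi T)).
Qed.

Lemma mul_B N k (Psi : Gr R N k -> R) (T : Gr R N k) :
  (T : 'M[R]_N) *m B_ Psi T = Psi T *: (T : 'M[R]_N).
Proof.
have [_ TT _] := GrP T.
rewrite /B_ mulmxDr -scalemxAr TT !mulmxA mulmxBr mulmx1 TT subrr !mul0mx.
by rewrite addr0.
Qed.

(** Covers the diagonal, about which (USAC) says nothing: [B_ Psi T] is some [K *m T] and vanishes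
    after multiplication by [1%:M - T], so [frob_kernel] applies. *)
Lemma frob_B_self (m n : nat) (Psi : Gr R (m + n) m -> R) T :
  frob (B_ Psi T) (B_ (dual Psi) (perp (erefl (m + n)%N) T)) = 0.
Proof.
have [Tt TT _] := GrP T.
have [K ->] := B_factor Psi T.
have [L ->] := B_factor (dual Psi) (perp (erefl (m + n)%N) T).
rewrite perpE; apply: frob_kernel; first exact: tr_perp.
by rewrite -mulmxA mulmxBr mulmx1 TT subrr mulmx0.
Qed.

(** By [mul_B], the product of [T] and [B_ Psi T] is a nonzero multiple of [T], so [B_ Psi T] has
    rank at least [m]. *)
Lemma dimker_B (m n : nat) (Psi : Gr R (m + n) m -> R) T : Psi T != 0 ->
  (dimker (B_ Psi T) <= n)%N.
Proof.
move=> p0; have [Tt TT tT] := GrP T.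
rewrite /dimker mxrank_ker mxrank_tr leq_subLR.
suff : (m <= \rank (B_ Psi T))%N by move=> h; rewrite leq_add2r.
have rT : \rank (T : 'M[R]_(m + n)) = m.
  by apply/eqP; rewrite -(eqr_nat R) -idempotent_trace// tT.
rewrite -[leqLHS]rT -(mxrank_scale_nz (T : 'M[R]_(m + n)) p0) -mul_B.
exact: mxrankM_maxr.
Qed.

End kernel.

(** * Continuity, measurability and integrability on the Grassmannian *)

Section continuity.
Context {R : realType}.

(** The formula for [B_] makes sense for all matrices once the chosen extension is inserted, so that
    continuity can be checked in the ambient space, as [grass_bounded] asks. *)
Lemma B_entry_continuous N k (Psi : Gr R N k -> R) : C1_Gr Psi ->
  exists2 f : 'M[R]_N -> 'M[R]_N, (forall T : Gr R N k, f T = B_ Psi T) &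
    forall X, grass R N k X -> {for X, continuous f}.
Proof.
move=> hPsi; have [FP [U [oU gU hU]]] := C1_extension_xget hPsi.
set F := xget _ _ in FP hU.
exists (fun X => F X *: X + (1%:M - X) *m (grad F X + (grad F X)^T) *m X).
  by move=> T; rewrite FP.
move=> X /gU /hU[dF cF].
have cX : id Y @[Y --> X] --> X by exact: cvg_id.
have c1 : F Y @[Y --> X] --> F X by exact: differentiable_continuous dF.
apply: (@cvgD _ _ _ (nbhs X)).
  by apply: cvgZ.
apply: cvg_mulmx => //; apply: cvg_mulmx.
  by apply: (@cvgB _ _ _ (nbhs X)) => //; exact: cvg_cst.
by apply: (@cvgD _ _ _ (nbhs X)) => //; exact: cvg_trmx.
Qed.

Lemma Gr_val_continuous N k : continuous (@mx_of_Gr R N k).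
Proof. exact: initial_continuous. Qed.

Lemma measurable_Gr (m n : nat) (f : GrBorel R m n -> R) :
  continuous (f : Gr R (m + n) m -> R) -> measurable_fun setT f.
Proof.
move=> /continuousP cf; apply: (measurability (@measurable_realfun.RGenOpens.G R)).
  exact: measurable_realfun.RGenOpens.measurableE.
move=> _ [_ [x [y ->]] <-]; rewrite setTI; apply: sub_sigma_algebra.
exact/cf/interval_open.
Qed.

Lemma integrable_Gr (m n : nat) (mu : probability (GrBorel R m n) R)
  (f : 'M[R]_(m + n) -> R) :
  (forall X, grass R (m + n) m X -> {for X, continuous f}) ->
  mu.-integrable setT (EFin \o (fun T : GrBorel R m n => f (T : Gr R (m + n) m))).
Proof.
move=> cf; apply: measurable_bounded_integrable => //.
- by rewrite (le_lt_trans (probability_le1 _ _))// ltry.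
- apply: measurable_Gr => T; apply: continuous_comp; first exact: Gr_val_continuous.
  exact/cf/GrP.
- have [M hM] := grass_bounded cf.
  exists M; split => [|x Mx T _]; first exact: num_real.
  exact: le_trans (hM _ (GrP T)) (ltW Mx).
Qed.

End continuity.

(** Both claims are proved together because additivity of the integral requires integrability of the
    remaining sum. *)
Lemma Rintegral_sum_fin d (T : measurableType d) (R : realType)
  (mu : {measure set T -> \bar R}) (I : finType) (f : I -> T -> R) :
  (forall i, mu.-integrable setT (EFin \o f i)) ->
  mu.-integrable setT (EFin \o (fun x => \sum_i f i x)) /\
  \int[mu]_x (\sum_i f i x) = \sum_i \int[mu]_x f i x.
Proof.
move=> fi; elim: (index_enum I) => [|i s [IH1 IH2]].
  split.
    rewrite (_ : _ \o _ = cst 0%E); first exact: integrable0.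
    by apply/funext => x /=; rewrite big_nil.
  rewrite big_nil; under eq_Rintegral do rewrite big_nil.
  by rewrite Rintegral_cst// mul0r.
have e : (fun x => \sum_(j <- i :: s) f j x) =
    (fun x => f i x + \sum_(j <- s) f j x).
  by apply/funext => x; rewrite big_cons.
rewrite e big_cons; split; last by rewrite RintegralD// IH2.
rewrite (_ : _ \o _ = (EFin \o f i) \+ (EFin \o (fun x => \sum_(j <- s) f j x)%R))%E.
  exact: integrableD.
by apply/funext => x /=; rewrite EFinD.
Qed.

(** * From (USAC) to the atomic condition *)

Section atomic.
Context {R : realType} {m n : nat}.
Variable Psi : Gr R (m + n) m -> R.
Hypotheses (C1Psi : C1_Gr Psi) (Psi0 : forall T, 0 < Psi T).
Hypothesis usac : uniform_scalar_atomic_condition Psi.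

Lemma B_entry_integrable (mu : probability (GrBorel R m n) R) i j :
  mu.-integrable setT (EFin \o (fun T : GrBorel R m n => B_ Psi T i j)).
Proof.
have [f fB cf] := B_entry_continuous C1Psi.
rewrite (_ : (fun T => _) =
  (fun T : GrBorel R m n => f (T : Gr R (m + n) m) i j)); last first.
  by apply/funext => T; rewrite fB.
apply: (integrable_Gr mu (f := fun X => f X i j)) => X gX.
exact: cvg_entry (cf _ gX).
Qed.

Lemma frob_A (mu : probability (GrBorel R m n) R) (M : 'M[R]_(m + n)) :
  mu.-integrable setT (EFin \o (fun T : GrBorel R m n => frob (B_ Psi T) M)) /\
  \int[mu]_T frob (B_ Psi T) M = frob (A_ Psi mu) M.
Proof.
have iM i j : mu.-integrable setT
    (EFin \o (fun T : GrBorel R m n => B_ Psi T i j * M i j)).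
  rewrite (_ : _ \o _ = fun T => ((B_ Psi T i j)%:E * (M i j)%:E)%E); last first.
    by apply/funext => T /=; rewrite EFinM.
  by apply: integrableZr => //; exact: B_entry_integrable.
have s i := Rintegral_sum_fin (iM i).
have [iS eS] := Rintegral_sum_fin (fun i => (s i).1).
rewrite (_ : (fun T => _) = (fun T : GrBorel R m n =>
  \sum_i \sum_j B_ Psi T i j * M i j)); last first.
  by apply/funext => T; rewrite frobE.
split => //; rewrite frobE eS; apply: eq_bigr => i _; rewrite (s i).2.
apply: eq_bigr => j _.
by rewrite mxE RintegralZr//; exact: B_entry_integrable.
Qed.

(** A nonnegative function with zero integral vanishes almost everywhere, and here it is positive
    off [S]. Concentration at [S] is expressed by a measurable null set containing every other
    point. *)
Lemma concentrated_of_kernel (mu : probability (GrBorel R m n) R) :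
  (n <= dimker (A_ Psi mu))%N ->
  exists (S : Gr R (m + n) m) (Z : set (GrBorel R m n)),
    [/\ measurable Z, mu Z = 0%E & forall T, T <> S -> Z T].
Proof.
move=> /kernel_projector[P gP AP]; have [Pt PP tP] := gP.
(* The kernel projector is taken as S^perp, so that the dual matrix at it has the form [K *m P]
   required by [frob_kernel]. *)
pose PG : Gr R (m + n) n := exist _ P (mem_set gP).
pose S : Gr R (m + n) m := perp (addnC n m) PG.
exists S.
have SP : perp (erefl (m + n)%N) S = PG.
  by apply: Gr_inj; rewrite !perpE opprB addrC subrK.
pose M := B_ (dual Psi) PG.
have [K KE] := B_factor (dual Psi) PG.
pose h (T : GrBorel R m n) := frob (B_ Psi T) M.
have [ih eh] := frob_A mu M.
have h_int : \int[mu]_T h T = 0 by rewrite eh /M KE frob_kernel.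
have [C C0 hC] := usac.
have h_ge (T : GrBorel R m n) : T <> S -> 0 < h T.
  move=> TS; rewrite /h /M -SP; apply: lt_le_trans (hC _ _ TS).
  rewrite mulr_gt0// exprn_gt0// lt_def frobnorm_ge0 andbT.
  apply/eqP => e; apply: TS; apply: Gr_inj; apply/eqP; rewrite -subr_eq0.
  by apply/eqP/frob_eq0; rewrite -sqr_frobnorm e expr0n.
have h_S : h S = 0 by rewrite /h /M -SP frob_B_self.
have h_ge0 T : 0 <= h T.
  by have [->|/h_ge/ltW//] := pselect (T = S); rewrite h_S.
have /integrableP[mh _] := ih.
(* The criterion for vanishing almost everywhere concerns the extended integral of the absolute
   value; nonnegativity removes the latter, integrability gives finiteness. *)
have E : (\int[mu]_T `|(h T)%:E| = 0)%E.
  under eq_integral do rewrite gee0_abs ?lee_fin//.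
  rewrite -[LHS]fineK; last exact: integrable_fin_num.
  by congr (_%:E); exact: h_int.
have [Z [mZ Z0 hZ]] := (ae_eq_integral_abs mu measurableT mh).1 E.
exists Z; split => // T /h_ge hT; apply: hZ => /= /(_ I) e.
have e0 : h T = 0 by case: e.
by rewrite e0 ltxx in hT.
Qed.

Lemma atomic_of_usac : atomic_condition Psi.
Proof.
split=> mu.
  (* Only a kernel of dimension at least [n] needs an argument. In that case the entries of [B_ Psi]
     are almost everywhere those of [B_ Psi S], and [mu] has mass 1, so the average is
     [B_ Psi S]. *)
  have [/concentrated_of_kernel[S [Z [mZ muZ hZ]]]|/ltnW//] :=
    leqP n (dimker (A_ Psi mu)).
  suff -> : A_ Psi mu = B_ Psi S by apply: dimker_B; exact: lt0r_neq0.
  apply/matrixP => i j; rewrite mxE.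
  have /integrableP[mf _] := B_entry_integrable mu i j.
  rewrite /Rintegral (@ae_eq_integral _ _ _ mu setT (cst (B_ Psi S i j)%:E))//.
    rewrite integral_cst// -[RHS]/(fine (B_ Psi S i j)%:E) -[in RHS](mule1 (_%:E)).
    by congr (fine (_ * _)%E); exact: probability_setT.
  by exists Z; split => // T /= hT; apply: hZ => TS; apply: hT => _; rewrite TS.
move=> dimA; have := @concentrated_of_kernel mu.
rewrite dimA => /(_ (leqnn n))[S [Z [mZ muZ hZ]]].
exists S => E mE.
(* A measurable set avoiding [S] lies inside [Z]; applied to [E] or to its complement, this
   determines [mu E]. *)
have null (F : set (GrBorel R m n)) : measurable F -> ~ F S -> mu F = 0%E.
  move=> mF FS; apply/eqP; rewrite -measure_le0 -muZ.
  apply: le_measure; rewrite ?inE//.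
  by move=> T FT; apply: hZ => TS; apply: FS; rewrite -TS.
rewrite diracE; have [ES|ES] := pselect (E S); last first.
  by rewrite memNset// null.
rewrite mem_set//; have := probability_setC mu mE.
rewrite null//; last exact: measurableC.
move=> e; have f : mu E \is a fin_num by exact: fin_num_measure.
have := f => /fineK h; move: e; rewrite -h -EFinB => -[] /eqP.
by rewrite eq_sym subr_eq0 => /eqP <-.
Qed.

End atomic.

Theorem theorem2 (R : realType) (m n : nat) (hm : (1 <= m)%N) (hn : (1 <= n)%N) :
  (exists2 eps : R, 0 < eps &
     forall Psi : Gr R (m + n) m -> R,
       C2_Gr Psi -> (C2norm (fun T => (Psi T - 1)%R) <= eps%:E)%E ->
       uniform_scalar_atomic_condition Psi) /\
  (forall Psi : Gr R (m + n) m -> R,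
     C1_Gr Psi -> (forall T, 0 < Psi T) ->
     uniform_scalar_atomic_condition Psi -> atomic_condition Psi).
Proof.
split; first exact: usac_near_one.
by move=> Psi C1Psi Psi0 usac; exact: atomic_of_usac.
Qed.
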